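(* Let $M$ be a countable locally finite structure such that algebraic closures of finite subsets of $M$ are finite, and let $G=\mathrm{Aut}(M)$. Suppose that, for some $n\geq 1$, \begin{enumerate} \item $G$ has a dense $n$-diagonal conjugacy class; \item the set of $n$-tuples in $G^n$ generating a non-precompact and non-discrete subgroup of $G$ is comeager in $G^n$. \end{enumerate} Then each topological $n$-similarity class in $L_0(G)$ is meager in $L_0(G)^n$.
   Context: A structure is a set with relations and functions; it is locally finite if all its finitely generated substructures are finite. $\mathrm{Aut}(M)$ carries the pointwise convergence topology ($M$ discrete), making it a Polish group. For finite $A\subseteq M$, $\mathrm{Aut}_A(M)$ is the pointwise stabilizer of $A$ in $\mathrm{Aut}(M)$, and the algebraic closure of $A$ is the set of all elements of $M$ whose orbit under the evaluation action of $\mathrm{Aut}_A(M)$ is finite. Let $\mu$ be the Lebesgue measure on $[0,1]$. For a Polish group $G$, $L_0(G)$ is the Polish group of all $\mu$-equivalence classes of $\mu$-measurable functions $[0,1]\to G$, with pointwise multiplication and the topology of convergence in measure: a basic neighbourhood of the identity is $\{f\in L_0(G)\colon \mu(\{x\colon f(x)\notin V\})<\epsilon\}$, where $V$ is a neighbourhood of the identity in $G$ and $\epsilon>0$. An $n$-diagonal conjugacy class of a group $H$ is an orbit of the action $g.(h_1,\ldots,h_n)=(gh_1g^{-1},\ldots,gh_ng^{-1})$ of $H$ on $H^n$. For an $n$-tuple $\bar f=(f_1,\ldots,f_n)$ in a topological group $H$, $\langle\bar f\rangle$ is the subgroup generated by $\{f_1,\ldots,f_n\}$. A subgroup is precompact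 if its closure in $H$ is compact, and discrete if its subspace topology is discrete. The topological $n$-similarity class of $\bar f$ (also called the $n$-dimensional class of topological similarity) is the set of all $\bar g=(g_1,\ldots,g_n)\in H^n$ such that the map $f_i\mapsto g_i$ extends (necessarily uniquely) to a bi-continuous group isomorphism between $\langle\bar f\rangle$ and $\langle\bar g\rangle$, taken with the subspace topologies. *)

(* Defs.v *)
From HB Require Import structures.
From mathcomp Require Import all_boot all_order all_algebra.
From mathcomp Require Import all_classical all_reals all_analysis.
From mathcomp Require Import generic_quotient.

Set Implicit Arguments.
Unset Strict Implicit.
Unset Printing Implicit Defensive.

Import Order.TTheory GRing.Theory Num.Theory.
Import numFieldNormedType.Exports.

Local Open Scope classical_set_scope.
Local Open Scope ring_scope.

Section category.
Context {X : topologicalType}.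

Definition nowhere_dense (A : set X) := interior (closure A) = set0.

Definition meager (A : set X) :=
  exists2 F : (set X)^nat,
    forall k, nowhere_dense (F k) & A `<=` \bigcup_k F k.

Definition comeager (A : set X) := meager (~` A).

End category.

(* No compatibility is required between the group law and the topology. *)
#[short(type="preTopologicalGroupType")]
HB.structure Definition PreTopologicalGroup :=
  {G of Topological G & Group G}.

HB.mixin Record PreTopologicalGroup_isTopologicalGroup G
    & PreTopologicalGroup G := {
  mulg_continuous : continuous (fun x : G * G => (x.1 * x.2)%g) ;
  invg_continuous : continuous (fun x : G => x^-1%g)
}.

#[short(type="topologicalGroupType")]
HB.structure Definition TopologicalGroup :=
  {G of PreTopologicalGroup G & PreTopologicalGroup_isTopologicalGroup G}.

HB.mixin Record isSecondCountable G & Topological G := {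
  second_countableT : @second_countable G
}.

#[short(type="secondCountableGroupType")]
HB.structure Definition SecondCountableGroup :=
  {G of TopologicalGroup G & isSecondCountable G}.

Section pretopological_group.
Context {G : preTopologicalGroupType}.
Implicit Types (S : set G) (n : nat).

Definition subgroup S :=
  [/\ S 1%g, (forall x y, S x -> S y -> S (x * y)%g)
    & forall x, S x -> S x^-1%g].

Definition generated S : set G := smallest subgroup S.

Definition precompact_set S := compact (closure S).

Definition discrete_set S := forall U : set (set_type S), open U.

Definition tuple_group n (f : {ptws 'I_n -> G}) : set G :=
  generated [set f i | i in [set: 'I_n]].

Definition diagonal_class n (f : {ptws 'I_n -> G}) : set {ptws 'I_n -> G} :=
  [set (fun i => g * f i * g^-1)%g | g in [set: G]].

(* [phi] and [psi] stand for mutually inverse isomorphisms between the two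
   generated subgroups; their values elsewhere are irrelevant. *)
Definition topologically_similar n (f g : {ptws 'I_n -> G}) :=
  let A := tuple_group f in
  let B := tuple_group g in
  exists phi psi : G -> G,
    [/\ [/\ forall x, A x -> B (phi x), forall y, B y -> A (psi y),
            forall x, A x -> psi (phi x) = x
          & forall y, B y -> phi (psi y) = y],
        forall x y, A x -> A y -> phi (x * y)%g = (phi x * phi y)%g,
        {within A, continuous phi}, {within B, continuous psi}
      & forall i, phi (f i) = g i].

Definition similarity_class n (f : {ptws 'I_n -> G}) : set {ptws 'I_n -> G} :=
  [set g | topologically_similar f g].

End pretopological_group.

Record language := Language {
  func_symbol : Type ;
  func_arity : func_symbol -> nat ;
  rel_symbol : Type ;
  rel_arity : rel_symbol -> nat
}.

Record structure (L : language) (T : Type) := Structure {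
  func_interp : forall s : func_symbol L, (func_arity s).-tuple T -> T ;
  rel_interp : forall r : rel_symbol L, (rel_arity r).-tuple T -> Prop
}.

Section model.
Context {L : language} {T : Type} (M : structure L T).

Definition substructure (S : set T) :=
  forall (s : func_symbol L) (t : (func_arity s).-tuple T),
    (forall i, S (tnth t i)) -> S (func_interp M t).

Definition locally_finite :=
  forall A : set T, finite_set A -> finite_set (smallest substructure A).

Definition automorphism (g : T -> T) :=
  [/\ bijective g,
      forall s (t : (func_arity s).-tuple T),
        g (func_interp M t) = func_interp M (map_tuple g t)
    & forall r (t : (rel_arity r).-tuple T),
        rel_interp M (map_tuple g t) <-> rel_interp M t].

End model.

Section automorphism_group.
Context {L : language} {T : countType} (M : structure L T).

Definition Aut : Type := {g : T -> T | `[< automorphism M g >]}.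

HB.instance Definition _ := Choice.on Aut.

Definition aut_fun (g : Aut) : T -> T := sval g.
Coercion aut_fun : Aut >-> Funclass.

Lemma autP (g : Aut) : automorphism M g.
Proof. exact/asboolP/(svalP g). Qed.

Lemma aut_ext (g h : Aut) : g =1 h -> g = h.
Proof. by move=> gh; apply: val_inj; apply/funext. Qed.

Definition aut_mk g (ag : automorphism M g) : Aut := exist _ g (asboolT ag).

Lemma aut_mkE g (ag : automorphism M g) : aut_mk ag = g :> (T -> T).
Proof. by []. Qed.

Lemma automorphism_id : automorphism M id.
Proof.
have E k (t : k.-tuple T) : map_tuple id t = t.
  by apply: val_inj; rewrite /= map_id.
by split=> [|s t|r t]; rewrite ?E//; exists id.
Qed.

Lemma automorphism_comp g h :
  automorphism M g -> automorphism M h -> automorphism M (g \o h).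
Proof.
move=> [bg fg rg] [bh fh rh].
have E k (t : k.-tuple T) : map_tuple (g \o h) t = map_tuple g (map_tuple h t).
  by apply: val_inj; rewrite /= map_comp.
split=> [|s t|r t]; first exact: bij_comp.
  by rewrite E -fg -fh.
by rewrite E; apply: iff_trans (rg _ _) (rh _ _).
Qed.

Lemma automorphism_inv g h : cancel g h -> cancel h g ->
  automorphism M g -> automorphism M h.
Proof.
move=> gh hg [bg fg rg].
have E k (t : k.-tuple T) : map_tuple g (map_tuple h t) = t.
  by apply: val_inj; rewrite /= -map_comp -[RHS]map_id; apply: eq_map.
split=> [|s t|r t]; first by exists g.
  by apply: (can_inj gh); rewrite hg fg E.
by rewrite -{2}(E _ t); apply: iff_sym; apply: rg.
Qed.

Lemma aut_inv_subproof (g : Aut) : exists h : Aut, cancel g h /\ cancel h g.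
Proof.
have [[h gh hg] _ _] := autP g.
by exists (aut_mk (automorphism_inv gh hg (autP g))).
Qed.

Definition aut_one : Aut := aut_mk automorphism_id.
Definition aut_mul (g h : Aut) : Aut := aut_mk (automorphism_comp (autP g) (autP h)).
Definition aut_inv (g : Aut) : Aut := projT1 (cid (aut_inv_subproof g)).

Lemma aut_invK (g : Aut) : cancel g (aut_inv g).
Proof. by rewrite /aut_inv; case: cid => h []. Qed.

Lemma aut_invKV (g : Aut) : cancel (aut_inv g) g.
Proof. by rewrite /aut_inv; case: cid => h []. Qed.

Lemma aut_mulA : associative aut_mul. Proof. by move=> f g h; apply: aut_ext. Qed.
Lemma aut_mul1 : left_id aut_one aut_mul. Proof. by move=> f; apply: aut_ext. Qed.
Lemma aut_mulr1 : right_id aut_one aut_mul. Proof. by move=> f; apply: aut_ext. Qed.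
Lemma aut_mulV : left_inverse aut_one aut_inv aut_mul.
Proof. by move=> f; apply: aut_ext => x; exact: aut_invK. Qed.
Lemma aut_mulrV : right_inverse aut_one aut_inv aut_mul.
Proof. by move=> f; apply: aut_ext => x; exact: aut_invKV. Qed.

HB.instance Definition _ := isGroup.Build Aut
  aut_mulA aut_mul1 aut_mulr1 aut_mulV aut_mulrV.

HB.instance Definition _ := Topological.copy Aut
  (initial_topology (aut_fun : Aut -> {ptws T -> discrete_topology T})).

Definition stabilizer (A : set T) : set Aut :=
  [set g | forall x, A x -> g x = x].

Definition acl (A : set T) : set T :=
  [set x | finite_set [set (g : Aut) x | g in stabilizer A]].

End automorphism_group.

Section automorphism_group_topology.
Context {L : language} {T : countType} (M : structure L T).
Local Notation G := (Aut M).

Lemma aut_cvgP (F : set_system G) (g : G) : Filter F ->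
  F --> g <-> forall t, F [set h : G | h t = g t].
Proof.
move=> FF; split=> [Fg t|Fg A].
  apply: Fg; apply: open_nbhs_nbhs; split=> //.
  pose ev := fun h : {ptws T -> discrete_topology T} => h t.
  exists (ev @^-1` [set g t]) => //.
  apply: open_comp; last exact: discrete_open.
  by move=> h _; exact: (@proj_continuous T (fun=> discrete_topology T) t h).
move=> [_ [[B oB <-] Bg BA]].
suff: F (aut_fun (M := M) @^-1` B) by apply: filterS.
have : (aut_fun (M := M) @ F) --> (aut_fun g : {ptws T -> discrete_topology T}).
  apply/cvg_sup => t U [V [[W oW <-] Wg WU]].
  apply: (@filterS _ F _ [set h : G | h t = g t]); last exact: Fg.
  by move=> h /= hg; apply: WU; rewrite /= hg.
by apply; apply: open_nbhs_nbhs.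
Qed.

Lemma aut_nbhs (g : G) t : nbhs g [set h : G | h t = g t].
Proof. by apply: (aut_cvgP g _).1. Qed.

Lemma aut_mul_continuous : continuous (fun x : G * G => (x.1 * x.2)%g).
Proof.
move=> [g h]; apply/aut_cvgP => t.
exists ([set k : G | k (aut_fun h t) = aut_fun g (aut_fun h t)],
        [set k : G | k t = aut_fun h t]); first by split; exact: aut_nbhs.
move=> [k l] [/= kE lE].
by change (aut_fun k (aut_fun l t) = aut_fun g (aut_fun h t)); rewrite lE kE.
Qed.

Lemma aut_inv_continuous : continuous (fun x : G => x^-1%g).
Proof.
move=> g; apply: (aut_cvgP (aut_inv g) (fmap_filter _ (nbhs_filter g))).2 => t.
apply: (@filterS _ (nbhs g) _ _ _ _ (aut_nbhs g (aut_inv g t))) => h hE.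
change (aut_inv h t = aut_inv g t).
by rewrite -[X in aut_inv h X](aut_invKV g t) -hE aut_invK.
Qed.

HB.instance Definition _ := PreTopologicalGroup_isTopologicalGroup.Build G
  aut_mul_continuous aut_inv_continuous.

Lemma aut_second_countable : @second_countable G.
Proof.
pose U (s : seq (T * T)) := [set g : G | forall p, p \in s -> g p.1 = p.2].
have UI s g : U s g -> nbhs g (U s).
  elim: s => [|p s IH] Usg; first by apply: filterS filterT.
  have pg : g p.1 = p.2 by apply: Usg; rewrite mem_head.
  have /IH : U s g by move=> q qs; apply: Usg; rewrite inE qs orbT.
  apply: filterS2 (aut_nbhs g p.1) => h /= hg hs q.
  by rewrite inE => /predU1P[->|/hs//]; rewrite hg.
exists (range U); first exact: card_le_trans (card_image_le _ _) (countableP _).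
split=> [_ [s _ <-]|g].
  by rewrite openE => g /UI.
have FF : Filter (filter_from [set V | range U V /\ V g] id).
  apply: filter_from_filter.
    by exists (U [::]); split=> //; exists [::].
  move=> _ _ [[s _ <-] Usg] [[s' _ <-] Us'g]; exists (U (s ++ s')).
    split; first by exists (s ++ s').
    by move=> p; rewrite mem_cat => /orP[/Usg|/Us'g].
  by move=> h Uh; split=> p ps; apply: Uh; rewrite mem_cat ps ?orbT.
apply/aut_cvgP => t; exists (U [:: (t, aut_fun g t)]) => /=.
  split; first by exists [:: (t, aut_fun g t)].
  by move=> p; rewrite inE => /eqP ->.
by move=> h /(_ (t, aut_fun g t)); rewrite inE; apply.
Qed.

HB.instance Definition _ := isSecondCountable.Build G aut_second_countable.

End automorphism_group_topology.

Definition borel (G : Type) : Type := G.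

Section borel.
Context {G : preTopologicalGroupType}.

HB.instance Definition _ := Choice.on (borel G).
HB.instance Definition _ := isPointed.Build (borel G) (1%g : G).
HB.instance Definition _ := @isMeasurable.Build (sigma_display (@open G))
  (borel G) <<s @open G >> (@sigma_algebra0 _ setT (@open G))
  (@sigma_algebraC (borel G) (@open G))
  (@sigma_algebra_bigcup _ setT (@open G)).

End borel.

Lemma bigcup_countable_measurable d (X : measurableType d) (I : Type)
    (D : set I) (F : I -> set X) :
  countable D -> (forall i, D i -> measurable (F i)) ->
  measurable (\bigcup_(i in D) F i).
Proof.
move=> /countable_injP[r rinj] mF.
rewrite (_ : \bigcup_(i in D) F i =
    \bigcup_n \bigcup_(i in [set i | D i /\ r i = n]) F i); last first.
  apply/seteqP; split=> [x [i Di Fx]|x [n _ [i [Di _] Fx]]]; last by exists i.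
  by exists (r i) => //; exists i.
apply: bigcupT_measurable => n.
have [[i [Di ri]]|nD] := pselect (exists i, D i /\ r i = n).
  rewrite (_ : [set i | _] = [set i]) ?bigcup_set1; first exact: mF.
  apply/seteqP; split=> [j [Dj rj]|_ ->//]; apply: rinj; rewrite ?inE//.
  by rewrite ri.
rewrite (_ : [set i | _] = set0) ?bigcup_set0; first exact: measurable0.
by apply/seteqP; split=> // i Di; apply: nD; exists i.
Qed.

Section measurable_functions.
Context d (X : measurableType d) (G : secondCountableGroupType).
Implicit Types (f g : X -> G) (V : set G).

Lemma borel_measurableP f :
  measurable_fun [set: X] (f : X -> borel G) <->
  forall V, open V -> measurable (f @^-1` V).
Proof.
split=> [mf V oV|fo].
  by rewrite -[_ @^-1` _]setTI; apply: mf => //; exact: sub_sigma_algebra.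
apply: (@measurability _ _ _ (borel G) _ _ (@open G)) => // _ [V oV <-].
by rewrite setTI; exact: fo.
Qed.

Lemma measurable_mulg f g :
  measurable_fun [set: X] (f : X -> borel G) ->
  measurable_fun [set: X] (g : X -> borel G) ->
  measurable_fun [set: X] ((fun x => f x * g x)%g : X -> borel G).
Proof.
move=> /borel_measurableP mf /borel_measurableP mg.
apply/borel_measurableP => V oV.
have [B cB [Bo Bb]] := @second_countableT G.
pose P := [set AB : set G * set G | [/\ B AB.1, B AB.2 &
  forall a b, AB.1 a -> AB.2 b -> V (a * b)%g]].
rewrite (_ : _ @^-1` V =
    \bigcup_(AB in P) (f @^-1` AB.1 `&` g @^-1` AB.2)); last first.
  apply/seteqP; split=> [x Vx|x [[A C] [/= _ _ hAC] [/= fA gC]]]; last exact: hAC.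
  have /(@mulg_continuous G (f x, g x)) [[A C] [/= /Bb [A' [BA' A'f] A'A]
    /Bb [C' [BC' C'g] C'C]] hAC] : nbhs (f x * g x)%g V by exact: open_nbhs_nbhs.
  exists (A', C') => //; split=> //= a c /A'A Aa /C'C Cc.
  exact: (hAC (a, c)).
apply: bigcup_countable_measurable.
  apply: (@sub_countable _ _ _ (B `*` B)); last exact: countableX.
  by apply: subset_card_le => -[A C] [].
by move=> [A C] [/= /Bo ? /Bo ? _]; apply: measurableI; [exact: mf|exact: mg].
Qed.

Lemma measurable_invg f :
  measurable_fun [set: X] (f : X -> borel G) ->
  measurable_fun [set: X] ((fun x => (f x)^-1)%g : X -> borel G).
Proof.
move=> /borel_measurableP mf; apply/borel_measurableP => V oV.
rewrite (_ : _ @^-1` V = f @^-1` ((fun y : G => y^-1%g) @^-1` V))//.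
apply: mf; apply: open_comp oV => x _.
exact: invg_continuous.
Qed.

End measurable_functions.

(* [L0 mu G] consists of the classes, modulo [mu]-almost everywhere equality,
   of measurable functions into [G]. Second countability of [G] makes pointwise
   products measurable. *)
Definition L0 d (X : measurableType d) (R : realType)
  (mu : {measure set X -> \bar R}) (G : secondCountableGroupType) : Type :=
  {mfun_ mu, X >-> borel G}.

Section L0.
Context d (X : measurableType d) (R : realType).
Context (mu : {measure set X -> \bar R}) (G : secondCountableGroupType).
Local Notation H := (L0 mu G).
Local Open Scope quotient_scope.

HB.instance Definition _ := Choice.on H.

Definition L0_fun (f : H) : X -> G := repr (f : {mfun_ mu, X >-> borel G}).
Coercion L0_fun : H >-> Funclass.

Lemma measurable_L0 (f : H) : measurable_fun [set: X] (f : X -> borel G).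
Proof. exact: measurable_funPT. Qed.

Definition L0_class (f : X -> G)
    (mf : measurable_fun [set: X] (f : X -> borel G)) : H :=
  \pi_({mfun_ mu, X >-> borel G}) (mfun_Sub (mem_set mf)).

Lemma L0_ext (f g : H) : (\forall x \ae mu, f x = g x) -> f = g.
Proof.
move=> fg; rewrite -[f]reprK -[g]reprK; apply/eqmodP/asboolP.
by apply: filterS fg.
Qed.

Lemma L0_classE (f : X -> G) mf : \forall x \ae mu, @L0_class f mf x = f x.
Proof.
have /eqmodP/asboolP : repr (@L0_class f mf) =
  mfun_Sub (mem_set mf) %[mod {mfun_ mu, X >-> borel G}] by rewrite reprK.
by apply: filterS => x; apply.
Qed.

Definition L0_one : H := L0_class (measurable_cst (1%g : borel G)).
Definition L0_mul (f g : H) : H :=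
  L0_class (measurable_mulg (measurable_L0 f) (measurable_L0 g)).
Definition L0_inv (f : H) : H := L0_class (measurable_invg (measurable_L0 f)).

Lemma L0_oneE : \forall x \ae mu, L0_one x = 1%g.
Proof. exact: L0_classE. Qed.

Lemma L0_mulE (f g : H) : \forall x \ae mu, L0_mul f g x = (f x * g x)%g.
Proof. exact: L0_classE. Qed.

Lemma L0_invE (f : H) : \forall x \ae mu, L0_inv f x = (f x)^-1%g.
Proof. exact: L0_classE. Qed.

Lemma L0_mulA : associative L0_mul.
Proof.
move=> f g h; apply: L0_ext.
have E1 := L0_mulE f (L0_mul g h); have E2 := L0_mulE g h.
have E3 := L0_mulE (L0_mul f g) h; have E4 := L0_mulE f g.
by near=> x; rewrite (near E1 x)// (near E2 x)// (near E3 x)// (near E4 x)// mulgA.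
Unshelve. all: by end_near. Qed.

Lemma L0_mul1 : left_id L0_one L0_mul.
Proof.
move=> f; apply: L0_ext; have E1 := L0_mulE L0_one f; have E2 := L0_oneE.
by near=> x; rewrite (near E1 x)// (near E2 x)// mul1g.
Unshelve. all: by end_near. Qed.

Lemma L0_mulr1 : right_id L0_one L0_mul.
Proof.
move=> f; apply: L0_ext; have E1 := L0_mulE f L0_one; have E2 := L0_oneE.
by near=> x; rewrite (near E1 x)// (near E2 x)// mulg1.
Unshelve. all: by end_near. Qed.

Lemma L0_mulV : left_inverse L0_one L0_inv L0_mul.
Proof.
move=> f; apply: L0_ext; have E1 := L0_mulE (L0_inv f) f.
have E2 := L0_invE f; have E3 := L0_oneE.
by near=> x; rewrite (near E1 x)// (near E2 x)// (near E3 x)// mulVg.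
Unshelve. all: by end_near. Qed.

Lemma L0_mulrV : right_inverse L0_one L0_inv L0_mul.
Proof.
move=> f; apply: L0_ext; have E1 := L0_mulE f (L0_inv f).
have E2 := L0_invE f; have E3 := L0_oneE.
by near=> x; rewrite (near E1 x)// (near E2 x)// (near E3 x)// mulgV.
Unshelve. all: by end_near. Qed.

HB.instance Definition _ := isGroup.Build H
  L0_mulA L0_mul1 L0_mulr1 L0_mulV L0_mulrV.

(* Requiring [V] to be open makes the set being measured measurable; this yields
   the same topology as arbitrary neighbourhoods [V] of the identity. *)
Definition L0_nbhd1 (V : set G) (e : R) : set H :=
  [set f | (mu [set x | ~ V (f x)] < e%:E)%E].

Definition L0_nbhs (f : H) : set_system H :=
  filter_from [set Ve : set G * R | open_nbhs 1%g Ve.1 /\ 0 < Ve.2]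
    (fun Ve => [set (f * h)%g | h in L0_nbhd1 Ve.1 Ve.2]).

HB.instance Definition _ := hasNbhs.Build H L0_nbhs.

Lemma measurable_notin (f : H) (V : set G) :
  open V -> measurable [set x | ~ V (f x)].
Proof.
move=> oV; rewrite (_ : [set _ | _] = ~` (f @^-1` V))//.
by apply: measurableC; have /borel_measurableP := measurable_L0 f; exact.
Qed.

Lemma ae_le_measureU (A B C : set X) : measurable A -> measurable B ->
  measurable C -> (\forall x \ae mu, A x -> B x \/ C x) ->
  (mu A <= mu B + mu C)%E.
Proof.
move=> mA mB mC [Z [mZ Z0 ABCZ]].
have mBC := measurableU _ _ mB mC.
apply: (@le_trans _ _ (mu ((B `|` C) `|` Z))).
  apply: le_measure; rewrite ?inE//; first exact: measurableU.
  move=> x Ax; have [?|nBC] := pselect (B x \/ C x); first by left.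
  by right; apply: ABCZ => /(_ Ax).
apply: (le_trans (measureU2 _ mBC mZ)).
by rewrite [X in (_ + X)%E]Z0 adde0; exact: measureU2.
Qed.

Lemma L0_nbhd1_one (V : set G) e : open_nbhs 1%g V -> 0 < e ->
  L0_nbhd1 V e 1%g.
Proof.
move=> [oV V1] e0; rewrite /L0_nbhd1/=.
apply: (@le_lt_trans _ _ (mu set0 + mu set0)%E).
  apply: ae_le_measureU => //; first exact: measurable_notin.
  by apply: filterS L0_oneE => x; rewrite /= => ->.
by rewrite !measure0 adde0 lte_fin.
Qed.

Lemma L0_nbhd1_sub (V W : set G) d1 e : open V -> open W -> V `<=` W ->
  d1 <= e -> L0_nbhd1 V d1 `<=` L0_nbhd1 W e.
Proof.
move=> oV oW VW de f; rewrite /L0_nbhd1/= => fV.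
apply: lt_le_trans (_ : d1%:E <= _)%E; last by rewrite lee_fin.
apply: le_lt_trans fV; apply: le_measure; rewrite ?inE; try exact: measurable_notin.
by move=> x /=; apply: contra_not; exact: VW.
Qed.

Lemma L0_nbhd1_mul (V : set G) e : open_nbhs 1%g V -> 0 < e ->
  exists W, [/\ open_nbhs 1%g W & forall f g : H,
    L0_nbhd1 W (e / 2) f -> L0_nbhd1 W (e / 2) g -> L0_nbhd1 V e (f * g)%g].
Proof.
move=> [oV V1] e0.
have /(@mulg_continuous G (1%g, 1%g)) [[A C] [/= nA nC] hAC] :
  nbhs (1 * 1 : G)%g V by apply: open_nbhs_nbhs; rewrite mulg1.
have : nbhs (1 : G)%g (A `&` C) by exact: filterI.
rewrite nbhsE => -[W [oW W1] WAC]; exists W; split=> // f g fW gW.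
rewrite /L0_nbhd1/=; apply: (@le_lt_trans _ _
    (mu [set x | ~ W (f x)] + mu [set x | ~ W (g x)])%E).
  apply: ae_le_measureU; try exact: measurable_notin.
  apply: filterS (L0_mulE f g) => x /=; rewrite -[L0_mul f g]/(f * g)%g => ->.
  rewrite -not_andP; apply: contra_not => -[Wf Wg].
  by apply: (hAC (f x, g x)); split; [exact: (WAC _ Wf).1|exact: (WAC _ Wg).2].
by rewrite [e]splitr EFinD; exact: lteD.
Qed.

Lemma L0_nbhs_filter (f : H) : ProperFilter (nbhs f).
Proof.
apply: filter_from_proper; last first.
  move=> [V e] [/= V1 e0]; exists (f * 1)%g.
  by exists 1%g => //; exact: L0_nbhd1_one.
apply: filter_from_filter.
  by exists (setT, 1); split=> //=; split=> //; exact: openT.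
move=> [V e] [W d1] [/= [oV V1] e0] [/= [oW W1] d0].
have oVW := openI oV oW.
exists (V `&` W, Num.min e d1); first by split=> //=; rewrite lt_min e0.
move=> _ [h /= hVW <-]; split; exists h => //; apply: L0_nbhd1_sub hVW => //;
  by [exact: subIsetl|exact: subIsetr|rewrite ge_min lexx ?orbT].
Qed.

Lemma L0_nbhs_singleton (f : H) (A : set H) : nbhs f A -> A f.
Proof.
move=> [[V e] [/= V1 e0] fA]; apply: fA; exists 1%g; last exact: mulg1.
exact: L0_nbhd1_one.
Qed.

Lemma L0_nbhs_nbhs (f : H) (A : set H) : nbhs f A -> nbhs f (nbhs^~ A).
Proof.
move=> [[V e] [/= V1 e0] fA]; have [W [W1 WV]] := L0_nbhd1_mul V1 e0.
have e20 : 0 < e / 2 by rewrite divr_gt0.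
exists (W, e / 2) => // _ [h /= hW <-]; exists (W, e / 2) => // _ [k /= kW <-].
by apply: fA; exists (h * k)%g; [exact: WV|rewrite mulgA].
Qed.

HB.instance Definition _ := Nbhs_isNbhsTopological.Build H
  L0_nbhs_filter L0_nbhs_singleton L0_nbhs_nbhs.

End L0.

Definition unit_interval (R : realType) : Type := {x : R | 0 <= x <= 1}.

Section unit_interval.
Context {R : realType}.
Local Notation I := (unit_interval R).

(* The domain of [completed_lebesgue_measure], i.e., [R] with the
   Lebesgue-measurable sets. *)
Definition lebesgue_line := caratheodory_type (wlength (@idfun R))^*%mu.

Lemma unit_interval0 : 0 <= (0 : R) <= 1. Proof. by rewrite lexx ler01. Qed.

HB.instance Definition _ := Choice.on I.
HB.instance Definition _ := isPointed.Build I (exist _ (0 : R) unit_interval0).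

Definition unit_image (A : set I) : set lebesgue_line := [set sval x | x in A].

Lemma unit_imageT : unit_image setT = `[0, 1]%classic.
Proof.
apply/seteqP; split=> [_ [[x x01] _ <-]|x x01]; first by rewrite /= in_itv.
by rewrite /= in_itv /= in x01; exists (exist _ x x01).
Qed.

Lemma unit_imageC A : unit_image (~` A) = unit_image setT `\` unit_image A.
Proof.
apply/seteqP; split=> [_ [x nAx <-]|_ [[x _ <-] nA]].
  by split; [exists x|move=> [y Ay /val_inj yx]; apply: nAx; rewrite -yx].
by exists x => // Ax; apply: nA; exists x.
Qed.

Lemma unit_image_bigcup (F : (set I)^nat) :
  unit_image (\bigcup_i F i) = \bigcup_i unit_image (F i).
Proof. exact: image_bigcup. Qed.

Definition unit_measurable : set (set I) := [set A | measurable (unit_image A)].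

Lemma unit_measurableT : unit_measurable setT.
Proof.
rewrite /unit_measurable/= unit_imageT.
by apply: sub_caratheodory; exact: measurable_itv.
Qed.

Lemma unit_measurable0 : unit_measurable set0.
Proof. by rewrite /unit_measurable/= /unit_image image_set0. Qed.

Lemma unit_measurableC A : unit_measurable A -> unit_measurable (~` A).
Proof.
rewrite /unit_measurable/= unit_imageC => mA.
by apply: measurableD => //; exact: unit_measurableT.
Qed.

Lemma unit_measurable_bigcup (F : (set I)^nat) :
  (forall i, unit_measurable (F i)) -> unit_measurable (\bigcup_i F i).
Proof.
move=> mF; rewrite /unit_measurable/= unit_image_bigcup.
exact: bigcupT_measurable.
Qed.

Fact unit_interval_display : measure_display. Proof. exact. Qed.

HB.instance Definition _ := @isMeasurable.Build unit_interval_display I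
  unit_measurable unit_measurable0 unit_measurableC unit_measurable_bigcup.

Definition unit_lebesgue (A : set I) : \bar R :=
  completed_lebesgue_measure (unit_image A).

Let unit_lebesgue0 : unit_lebesgue set0 = 0%E.
Proof. by rewrite /unit_lebesgue /unit_image image_set0 measure0. Qed.

Let unit_lebesgue_ge0 A : (0 <= unit_lebesgue A)%E.
Proof. exact: measure_ge0. Qed.

Let unit_lebesgue_semi_sigma_additive : semi_sigma_additive unit_lebesgue.
Proof.
move=> F mF tF mUF; rewrite /unit_lebesgue unit_image_bigcup.
apply: measure_semi_sigma_additive => //.
  move=> i j _ _ [_ [[x Fx <-] [y Fy /val_inj yx]]].
  by apply: tF => //; exists x; split=> //; rewrite -yx.
by rewrite -unit_image_bigcup.
Qed.

HB.instance Definition _ := isMeasure.Build _ I R unit_lebesgue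
  unit_lebesgue0 unit_lebesgue_ge0 unit_lebesgue_semi_sigma_additive.

Let unit_lebesgueT : unit_lebesgue setT = 1%E.
Proof.
rewrite /unit_lebesgue unit_imageT.
have -> : completed_lebesgue_measure (`[0, 1]%classic : set lebesgue_line) =
  lebesgue_measure (`[0, 1]%classic : set R) by [].
by rewrite lebesgue_measure_itv/= lte_fin ltr01 sube0.
Qed.

HB.instance Definition _ :=
  Measure_isProbability.Build _ I R unit_lebesgue unit_lebesgueT.

End unit_interval.

(* Main.v *)
Require Import Defs.
From HB Require Import structures.
From mathcomp Require Import all_boot all_order all_algebra.
From mathcomp Require Import all_classical all_reals all_analysis.
From mathcomp Require Import zify lra.

(** Write [G] for the automorphism group and [H] for [L0] of [G]. A tuple [g]
    of elements of [H] induces a group topology on the words in [n] letters,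
    through the evaluation of words at [g], and all members of a similarity
    class [C] induce the same one ([similar_nbhs]). Suppose that [C] is not
    meager.

    The topology on words is then bounded by a topology that depends on [G]
    only. Let [W] be a set of words such that, for every tuple [h] of [G] and
    every neighbourhood of [h] and of the identity, some word of [W] takes at
    some tuple near [h] a value near the identity. Step functions whose values
    are conjugates of one tuple with dense diagonal class are dense in [H]^n,
    and a word that is close enough to the identity at that tuple is close to
    it at finitely many given conjugates; hence [W] comes arbitrarily close to
    the identity at comeagerly many tuples of [H] ([recurrent_comeager]), in
    particular at a member of [C], and so at all of them. Applied to the set of
    the words whose value at [g] is far from the identity, this says that, for
    [g] in [C] and an open subgroup [V] of [G], there are [q] and [h] such that
    every word of [nearly_trivial q h] is [V]-valued at [g] on at least half of
    the unit interval. These closed conditions on [g] are countable in number,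
    since [q] and the relevant part of [h] range over countable sets.

    By non-precompactness, a generic tuple of [G] has an infinite orbit, and a
    Baire category argument in [G]^n confines a point of it to a finite set:
    generically in [g], there is a [p] for which the values of [g] belong to the
    open set [mostly_infinite p] on more than half of the interval. Let [V] be
    the pointwise stabilizer of the [p]-th segment. It remains to see that the
    closed conditions are nowhere dense on the open set of such [g]
    ([coarse_cell_nowhere_dense]). A neighbourhood contains, along with a step
    function with values [h i], all step functions with values [h' i] agreeing
    with the [h i] on a finite set; on more than half of the interval, [h i] can
    be taken with an infinite orbit through a point [t i] of the segment. As
    algebraic closures are finite, a common reduced word [v] leads each such
    [t i] out of the algebraic closure of the finite set on which [h i] must be
    kept ([leave_all_finite]). Past that exit, each letter of a reduced word
    applies at a point where the automorphism is still free, and [h i] can be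
    modified so that the path never comes back ([free_path], [escape]). Finally
    non-discreteness provides nontrivial words with values arbitrarily close to
    the identity, and conjugating them yields a word of [nearly_trivial q h]
    that is reduced and begins with [v] ([reduced_prefix]; powers are used when
    there is one generator). Its value at the modified tuples moves each [t i],
    so it is not in [V], on more than half of the interval. *)

Set Implicit Arguments.
Unset Strict Implicit.
Unset Printing Implicit Defensive.

Import Order.TTheory GRing.Theory Num.Theory.

Local Open Scope classical_set_scope.

(** * Group words *)

Section words.
Context {n : nat}.

(** The boolean of a letter tells whether the generator is inverted. *)
Definition letter : Type := ('I_n * bool)%type.
Definition linv (l : letter) : letter := (l.1, ~~ l.2).
Definition winv (w : seq letter) := rev (map linv w).
Definition reduced (w : seq letter) := sorted (fun l m => m != linv l) w.

Lemma linvK : involutive linv.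
Proof. by case=> j b; rewrite /linv /= negbK. Qed.

Lemma linv_neq l : linv l != l.
Proof. by case: l => j b; rewrite /linv xpair_eqE /= eqxx; case: b. Qed.

Lemma linv_neqC l m : (l != linv m) = (m != linv l).
Proof. by rewrite -(inj_eq (inv_inj linvK)) linvK eq_sym. Qed.

Lemma letter_cases (l m : letter) : [\/ m = l, m = linv l | m.1 != l.1].
Proof.
have [|ml] := eqVneq m.1 l.1; last by constructor 3.
case: l m => j b [_ c] /= ->.
by case: b c => [] []; [constructor 1|constructor 2|constructor 2|constructor 1].
Qed.

Lemma winv_reduced w : reduced w -> reduced (winv w).
Proof.
rewrite /reduced /winv rev_sorted sorted_map; apply: sub_sorted => l m /= lm.
by rewrite linvK eq_sym.
Qed.

Section eval.
Context {G : groupType}.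
Implicit Types (h : 'I_n -> G) (w : seq letter).
Local Open Scope group_scope.

Definition leval h (l : letter) : G := if l.2 then (h l.1)^-1 else h l.1.

(** The letters of a word are multiplied from right to left, so that a word
    of automorphisms acts on a point one letter after the other. *)
Fixpoint weval h w : G :=
  if w is l :: w' then weval h w' * leval h l else 1.

Lemma leval_linv h l : leval h (linv l) = (leval h l)^-1.
Proof. by case: l => j []; rewrite /leval /= ?invgK. Qed.

Lemma weval_cat h u v : weval h (u ++ v) = weval h v * weval h u.
Proof. by elim: u => [|l u IH] /=; rewrite ?mulg1// IH mulgA. Qed.

Lemma weval_rcons h u l : weval h (rcons u l) = leval h l * weval h u.
Proof. by rewrite -cats1 weval_cat /= mul1g. Qed.

Lemma weval_winv h w : weval h (winv w) = (weval h w)^-1.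
Proof.
elim: w => [|l w IH]; first by rewrite invg1.
by rewrite /winv /= rev_cons weval_rcons IH leval_linv invgM.
Qed.

Lemma weval_nseq h l k : weval h (nseq k l) = leval h l ^+ k.
Proof. by elim: k => //= k ->; rewrite expgSr. Qed.

Lemma reduced_wordP h w : exists2 u, reduced u & weval h u = weval h w.
Proof.
elim: w => [|l w [u ru IH]]; first by exists [::].
case: u ru IH => [|m u] ru IH; first by exists [:: l] => //=; rewrite -IH.
have [ml|ml] := eqVneq m (linv l).
  exists u; first exact: path_sorted ru.
  by rewrite /= -IH /= ml leval_linv mulgVK.
by exists [:: l, m & u]; rewrite /reduced /= ?ml//= -IH.
Qed.

End eval.

Lemma subgroup_tuple_group (G : preTopologicalGroupType) (h : {ptws 'I_n -> G}) :
  subgroup (tuple_group h).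
Proof.
split=> [S [[]]//|x y xh yh S hS|x xh S hS].
  by have [[_ SM _] _] := hS; apply: SM; [exact: xh|exact: yh].
by have [[_ _ SV] _] := hS; apply: SV; exact: xh.
Qed.

Lemma tuple_groupP (G : preTopologicalGroupType) (h : {ptws 'I_n -> G}) (x : G) :
  tuple_group h x <-> exists w, x = weval h w.
Proof.
split=> [hx|[w ->]].
  apply: (hx [set y | exists w, y = weval h w]); split.
    split; [by exists [::]|by move=> _ _ [u ->] [v ->]; exists (v ++ u); rewrite weval_cat|].
    by move=> _ [u ->]; exists (winv u); rewrite weval_winv.
  by move=> _ [j _ <-]; exists [:: (j, false)]; rewrite /= mul1g.
move=> S [[S1 SM SV] hS]; elim: w => [|[j b] w IH] //=; apply: SM => //.
by rewrite /leval; case: b => /=; [apply: SV|]; apply: hS; exists j.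
Qed.

End words.
Arguments letter : clear implicits.

Section reduced_prefix.
Context {n : nat}.
Implicit Types w : seq (letter n).

Lemma winv_rcons (u : seq (letter n)) x : winv (rcons u x) = linv x :: winv u.
Proof. by rewrite /winv map_rcons rev_rcons. Qed.

Lemma path_reduced_nseq (y : letter n) u : (forall x : letter n, x = y \/ x = linv y) ->
  path (fun l m => m != linv l) y u -> u = nseq (size u) y.
Proof.
move=> xy; elim: u => //= x u IH; case: (xy x) => ->; last by rewrite eqxx.
by move=> /andP[_ /IH <-].
Qed.

(** Conjugating a nontrivial element of the free group by [v] followed by a
    suitable letter gives a reduced word that begins with [v]. With a single
    generator there may be no such letter; a power of the element, or of its
    inverse, does instead. *)
Lemma reduced_prefix (v z : seq (letter n)) : v != [::] -> reduced v -> z != [::] -> reduced z ->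
  exists2 w, reduced (v ++ w) &
    (exists x, v ++ w = (v ++ [:: x]) ++ z ++ winv (v ++ [:: x])) \/
    (exists k, forall (G : groupType) (h : 'I_n -> G), weval h (v ++ w) = weval h z ^+ k \/
                         weval h (v ++ w) = weval h (winv z) ^+ k)%g.
Proof.
case: v => [//|y v] _ rv; case: z => [//|a z] _ rz; pose l := last y v.
have [[x]|nx] :=
    pselect (exists x, x \notin [:: linv l; linv a; last a z]).
  rewrite !inE !negb_or => /and3P[xl xa xz].
  exists (x :: (a :: z) ++ winv ((y :: v) ++ [:: x])); last first.
    by left; exists x; rewrite -!catA.
  have wl : path (fun l m => m != linv l) (linv x) (winv (y :: v)).
    have := winv_reduced rv; rewrite (lastI y v) winv_rcons /= => ->.
    by rewrite linvK eq_sym -/l xl.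
  rewrite cats1 winv_rcons /reduced /= cat_path /= cat_path /=.
  rewrite /reduced /= in rv rz.
  by rewrite -/l -(linv_neqC x) (inj_eq (inv_inj linvK)) rv xl xa xz rz wl.
have xl (x : letter n) : x = y \/ x = linv y.
  have [|->|xy] := letter_cases y x; [by left|by right|].
  exfalso; apply: nx; apply/existsP; rewrite -negb_forall.
  apply/negP => /forallP all3; suff : (#|{: letter n}| <= 3)%N.
    have : nat_of_ord x.1 <> y.1 by move=> /val_inj /eqP; apply/negP.
    by have := ltn_ord x.1; have := ltn_ord y.1; rewrite card_prod card_ord card_bool; lia.
  apply: leq_trans (card_size [:: linv l; linv a; last a z]).
  by apply: subset_leq_card; apply/fintype.subsetP => c _; rewrite -[_ \in _]negbK all3.
have lE : l = y by rewrite /l (path_reduced_nseq xl rv); elim: (size v).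
have rE := path_reduced_nseq xl rv.
pose k := (size z).+1.
have [zE|zE] : a :: z = nseq k y \/ winv (a :: z) = nseq k y.
  have az (c : letter n) : c = a \/ c = linv a.
    by case: (xl a) (xl c) => -> [] ->; rewrite ?linvK; auto.
  have /= zE := path_reduced_nseq az rz; rewrite /k zE size_nseq.
  case: (xl a) => ->; [by left|right]; rewrite -[_ :: _]/(nseq (size z).+1 _).
  by rewrite /winv map_nseq linvK rev_nseq.
all: have vE : y :: v = nseq (size v).+1 y by rewrite /= -rE.
all: have rN i : reduced (nseq i y) by
  (case: i => // i; rewrite /reduced /=; elim: i => //= i ->; rewrite eq_sym linv_neq).
all: exists (nseq ((size v).+1 * size z) y); rewrite vE -nseqD -mulnS//.
all: right; exists (size v).+1 => G h; rewrite zE.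
1: left. 2: right.
all: by rewrite !weval_nseq mulnC expgnA.
Qed.

End reduced_prefix.

(** * Algebraic closure *)

Section algebraic_closure.
Context {L : language} {T : countType} {M : structure L T}.
Implicit Types (A B : set T) (g h : Aut M).
Local Open Scope group_scope.

Lemma autM g h t : (g * h : Aut M) t = g (h t). Proof. by []. Qed.

Lemma autVK g : cancel g (g^-1 : Aut M)%g.
Proof. exact: aut_invK. Qed.

Lemma autKV g : cancel (g^-1 : Aut M)%g g.
Proof. exact: aut_invKV. Qed.

Lemma aut_inj g : injective g.
Proof. exact: can_inj (autVK g). Qed.

Lemma sub_acl A : A `<=` acl M A.
Proof.
move=> x Ax; apply: (@sub_finite_set _ _ [set x]); last exact: finite_set1.
by move=> _ [g gA <-]; exact: gA.
Qed.

Lemma acl_mono A B : A `<=` B -> acl M A `<=` acl M B.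
Proof.
move=> AB x; apply: sub_finite_set => _ [g gB <-]; exists g => //.
by move=> y /AB /gB.
Qed.

Lemma not_acl A x S : ~ acl M A x -> finite_set S ->
  exists2 g : Aut M, stabilizer A g & ~ S (g x).
Proof.
move=> nx fS; apply: contrapT => nS; apply: nx; apply: sub_finite_set fS.
by move=> _ [g gA <-]; apply: contrapT => nSg; apply: nS; exists g.
Qed.

(** Two elements of the stabilizer of [A] that agree at [y] differ by an
    element fixing [y] as well, so the orbit of [x] over [A] is a union of
    translates, indexed by the orbit of [y], of its orbit over [y |` A]. *)
Lemma acl_step A x y : acl M A y -> acl M (y |` A) x -> acl M A x.
Proof.
move=> fy fx.
have tr z : exists g : Aut M, forall h : Aut M, stabilizer A h -> h y = z ->
    stabilizer A g /\ g y = z.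
  have [[g [gA gy]]|ng] := pselect (exists g : Aut M, stabilizer A g /\ g y = z).
    by exists g.
  by exists (1 : Aut M) => h hA hy; case: ng; exists h.
have [c cP] := choice tr.
apply: sub_finite_set (bigcup_finite fy (fun z _ => finite_image (c z) fx)).
move=> _ [g gA <-]; have [cA cy] := cP _ _ gA erefl.
exists (g y); first by exists g.
exists (((c (g y))^-1 * g : Aut M) x); last by rewrite autM autKV.
exists ((c (g y))^-1 * g) => //.
have cV t : (c (g y)) t = g t -> ((c (g y))^-1 * g : Aut M) t = t.
  by rewrite autM => <-; rewrite autVK.
by move=> t [->|At]; apply: (cV) => //; rewrite cA// gA.
Qed.

Lemma acl_idem A : finite_set (acl M A) -> acl M (acl M A) `<=` acl M A.
Proof.
move=> /finite_seqP[s sK].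
suff E (r : seq T) : {subset r <= s} -> acl M ([set` r] `|` A) `<=` acl M A.
  move=> x Kx; apply: (E s) => //; apply: acl_mono Kx => y.
  by rewrite sK; left.
elim: r => [_|y r IH yr x]; first by apply: acl_mono => x [].
have /IH{}IH : {subset r <= s} by move=> t tr; apply: yr; rewrite inE tr orbT.
move=> fx; apply: IH; apply: (acl_step (y := y)).
  apply: (@acl_mono A); first exact: subsetUr.
  by rewrite sK /= yr// mem_head.
apply: acl_mono fx => t [|At]; last by right; right.
by rewrite /= inE => /predU1P[->|tr]; [left|right; left].
Qed.

End algebraic_closure.

(** * Moving points along words *)

Section paths.
Context {L : language} {T : countType} {M : structure L T} {n : nat}.
Implicit Types (h : 'I_n -> Aut M) (K E : set T) (w : seq (letter n)).
Local Open Scope group_scope.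

Definition lact h (l : letter n) (t : T) : T := (leval h l : Aut M) t.
Definition wact h w (t : T) : T := (weval h w : Aut M) t.

Definition word_orbit h (t : T) : set T := [set wact h w t | w in [set: seq (letter n)]].

Lemma lact_false h j t : lact h (j, false) t = h j t. Proof. by []. Qed.

Lemma wact_cons h l w t : wact h (l :: w) t = wact h w (lact h l t).
Proof. by []. Qed.

Lemma wact_cat h u w t : wact h (u ++ w) t = wact h w (wact h u t).
Proof. by rewrite /wact weval_cat. Qed.

Lemma wact_rcons h u l t : wact h (rcons u l) t = lact h l (wact h u t).
Proof. by rewrite /wact weval_rcons. Qed.

Lemma lactK h l : cancel (lact h l) (lact h (linv l)).
Proof. by move=> t; rewrite /lact leval_linv autVK. Qed.

Lemma lactKV h l : cancel (lact h (linv l)) (lact h l).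
Proof. by move=> t; rewrite /lact leval_linv autKV. Qed.

Lemma wactK h w t : wact h (winv w) (wact h w t) = t.
Proof. by rewrite /wact weval_winv autVK. Qed.

Definition twist h (l : letter n) (g : Aut M) : 'I_n -> Aut M :=
  fun j => if j == l.1 then (if l.2 then g^-1 * h j else h j * g) else h j.

Lemma leval_twist h l g : leval (twist h l g) l = leval h l * g.
Proof. by case: l => j []; rewrite /leval /twist /= eqxx// invgM invgK. Qed.

Lemma lact_twist h l g t : lact (twist h l g) l t = lact h l (g t).
Proof. by rewrite /lact leval_twist. Qed.

Lemma lact_twist_linv h l g t :
  lact (twist h l g) (linv l) t = (g^-1 : Aut M) (lact h (linv l) t).
Proof. by rewrite /lact !leval_linv leval_twist invgM. Qed.

Lemma lact_twist_other h l m g t : m.1 != l.1 ->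
  lact (twist h l g) m t = lact h m t.
Proof. by move=> /negPf ml; rewrite /lact /leval /twist ml. Qed.

(** [D l] consists of the sources of the [l]-labelled edges that are
    prescribed. An edge can be read in both directions, so the prescription is
    symmetric under inversion of letters. *)
Definition edge_set h (D : letter n -> set T) :=
  forall l t, D l t -> D (linv l) (lact h l t).

Definition agree_on (D : letter n -> set T) h h' :=
  forall l t, D l t -> lact h' l t = lact h l t.

Lemma twist_agree h D l g : edge_set h D -> stabilizer (D l) g ->
  agree_on D h (twist h l g).
Proof.
move=> hD gD m t Dmt; have [ml|ml|ml] := letter_cases l m.
- by rewrite ml in Dmt *; rewrite lact_twist gD.
- rewrite ml in Dmt *; have := hD _ _ Dmt; rewrite linvK => /gD gE.
  by rewrite lact_twist_linv -{1}gE autVK.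
- by rewrite lact_twist_other.
Qed.

(** Once the path of a point leaves the algebraic closure of the part of the
    structure where the automorphisms are prescribed, each further letter of a
    reduced word applies at a point that is generic over the prescribed edges,
    the only bad edge being the one just taken; the automorphisms can thus be
    changed so that the path always moves to new points. The hypotheses on [D]
    say that [b] has just been reached through [l0] and that every other
    prescribed edge starts in [E]. *)
Lemma free_path w h D E l0 b :
  (forall A, finite_set A -> finite_set (acl M A)) ->
  finite_set E -> edge_set h D -> path (fun l m => m != linv l) l0 w ->
  (forall m, m != linv l0 -> D m `<=` E) -> D (linv l0) `<=` b |` E ->
  ~ acl M E b ->
  exists2 h', agree_on D h h' & ~ E (wact h' w b).
Proof.
move=> facl; elim: w h D E l0 b => [|x w IH] h D E l0 b fE hD.
  by move=> _ _ _ nb; exists h => // /sub_acl.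
move=> /= /andP[xl0 xw] DE Dl0 nb.
have fbE : finite_set (b |` E) by rewrite finite_setU; split.
(* The twist [g] fixes all sources of prescribed [x]-edges, and its value at
   [b] can be chosen outside of the preimage of a finite set. *)
have [g gE gb] : exists2 g : Aut M, stabilizer E g &
    ~ acl M (b |` E) (lact h x (g b)).
  have [g gE ng] := not_acl nb (finite_image (lact h (linv x)) (facl _ fbE)).
  exists g => // bad; apply: ng; exists (lact h x (g b)) => //.
  exact: lactK.
pose h1 := twist h x g; pose b1 := lact h1 x b.
have b1E : b1 = lact h x (g b) by exact: lact_twist.
have hh1 : agree_on D h h1.
  by apply: twist_agree => // t /(DE _ xl0); exact: gE.
pose D1 m := D m `|` [set t | (m = x /\ t = b) \/ (m = linv x /\ t = b1)].
have D1E m : m != linv x -> D1 m `<=` b |` E.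
  move=> mx t [Dmt|[[_ ->]|[mE]]]; [|by left|by rewrite mE eqxx in mx].
  have [ml0|/DE] := eqVneq m (linv l0); last by right; auto.
  by rewrite ml0 in Dmt; exact: Dl0.
have h1D1 : edge_set h1 D1.
  move=> m t [Dmt|[[-> ->]|[-> ->]]].
  - by left; rewrite hh1//; exact: hD.
  - by right; right.
  - by right; left; rewrite linvK; split=> //; exact: lactK.
have D1x : D1 (linv x) `<=` b1 |` (b |` E).
  move=> t [Dt|[[xx]|[_ ->]]]; [|by have := linv_neq x; rewrite {1}xx eqxx|by left].
  have [xl|xl] := eqVneq (linv x) (linv l0).
    by right; apply: Dl0; rewrite -xl.
  by right; right; exact: (DE _ xl).
have nb1 : ~ acl M (b |` E) b1 by rewrite b1E.
have [h' h1' nE] := IH h1 D1 (b |` E) x b1 fbE h1D1 xw D1E D1x nb1.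
exists h' => [m t Dmt|]; first by rewrite h1' ?hh1//; left.
rewrite wact_cons h1'; last by right; left.
by move=> bad; apply: nE; right.
Qed.

Fixpoint stays h K t w : Prop :=
  if w is l :: w' then K t /\ stays h K (lact h l t) w' else K t.

Lemma stays_start h K t w : stays h K t w -> K t.
Proof. by case: w => [|l w] // []. Qed.

Lemma stays_cat h K t u w : stays h K t (u ++ w) -> stays h K t u.
Proof.
elim: u t => [|l u IH] t /=; first exact: stays_start.
by move=> [Kt /IH].
Qed.

Lemma stays_end h K t w : stays h K t w -> K (wact h w t).
Proof. by elim: w t => [|l w IH] t //= [_ /IH]. Qed.

(** The part of the path before its exit from [K] runs along edges inside [K].
    Keeping these and the exit edge, [free_path] applies to the rest. *)
Lemma escape h K t w :
  (forall A, finite_set A -> finite_set (acl M A)) ->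
  finite_set K -> acl M K `<=` K -> reduced w -> K t -> ~ stays h K t w ->
  exists2 h' : 'I_n -> Aut M, (forall j s, K s -> K (h j s) -> h' j s = h j s) &
    ~ K (wact h' w t).
Proof.
move=> facl fK aclK.
suff S : reduced w -> K t -> ~ stays h K t w ->
    exists2 h' : 'I_n -> Aut M, (forall l s, K s -> K (lact h l s) -> lact h' l s = lact h l s) &
      ~ K (wact h' w t).
  move=> rw Kt /(S rw Kt)[h' hh' h'K]; exists h' => // j s.
  exact: (hh' (j, false)).
elim: w t => [//|l w IH] t rw Kt nst.
have [Klt|nKlt] := pselect (K (lact h l t)).
  have [h' hh' h'K] := IH _ (path_sorted rw) Klt (fun st => nst (conj Kt st)).
  by exists h' => //; rewrite wact_cons hh'.
pose D m := [set s | K s /\ K (lact h m s)] `|`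
  [set s | (m = l /\ s = t) \/ (m = linv l /\ s = lact h l t)].
have hD : edge_set h D.
  move=> m s [[Ks Kms]|[[-> ->]|[-> ->]]].
  - by left; split=> //; rewrite lactK.
  - by right; right.
  - by right; left; rewrite linvK; split=> //; exact: lactK.
have DK m : m != linv l -> D m `<=` K.
  by move=> ml s [[]//|[[_ ->]//|[mE]]]; rewrite mE eqxx in ml.
have Dl : D (linv l) `<=` lact h l t |` K.
  by move=> s [[Ks _]|[[_ ->]|[_ ->]]]; [right|right|left].
have [h' hh' h'K] := free_path facl fK hD rw DK Dl (fun Klt => nKlt (aclK _ Klt)).
exists h' => [m s Ks Kms|]; first by rewrite hh'//; left.
by rewrite wact_cons hh'//; right; left.
Qed.

End paths.

Section leaving.
Context {L : language} {T : countType} {M : structure L T} {n : nat}.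
Implicit Types (h : 'I_n -> Aut M) (K : set T) (w : seq (letter n)).

Lemma lact_nseq h l k t : wact h (nseq k l) t = iter k (lact h l) t.
Proof. by elim: k t => //= k IH t; rewrite wact_cons IH -iterSr. Qed.

(** If all reduced extensions of [v] kept the point in the finite set [K], the
    endpoints of these extensions would be closed under all letters: the only
    letter that does not prolong [v] is the inverse of its last letter [l], and
    its effect is that of a power of [l] because [l] permutes a finite set. *)
Lemma leave_finite h K t v : finite_set K -> infinite_set (word_orbit h t) ->
  reduced v -> v != [::] ->
  exists2 u, reduced (v ++ u) & ~ stays h K t (v ++ u).
Proof.
case: v => [//|y v] fK inf rv _; apply: contrapT => nu.
pose l := last y v; pose c := wact h (y :: v) t.
pose Y := [set wact h ((y :: v) ++ u) t | u in [set u | reduced ((y :: v) ++ u)]].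
have YK : Y `<=` K.
  move=> _ [u ru <-]; apply: (@stays_end _ _ _ _ h); apply: contrapT => nst.
  by apply: nu; exists u.
have fY := sub_finite_set YK fK.
have Yl k : Y (iter k (lact h l) c).
  exists (nseq k l); last by rewrite wact_cat lact_nseq.
  rewrite /reduced /= cat_path; apply/andP; split=> //.
  suff S m : path (fun a b => b != linv a) l (nseq m l) by exact: S.
  by elim: m => //= m ->; rewrite eq_sym linv_neq.
have [r rc] : exists r, iter r.+1 (lact h l) c = c.
  apply: contrapT => nr; apply: infinite_nat.
  have /finite_preimage : {in (fun k => iter k (lact h l) c) @^-1` Y &,
      injective (fun k => iter k (lact h l) c)}.
    have lt i j : (i < j)%N -> iter i (lact h l) c <> iter j (lact h l) c.
      move=> ij ijE; apply: nr; exists (j - i).-1.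
      rewrite prednK ?subn_gt0//; apply: (can_inj (wactK h (nseq i l))).
      by rewrite !lact_nseq -iterD subnKC// ltnW.
    move=> i j _ _ ijE; case: (ltngtP i j) => // /lt; first by move=> /(_ ijE).
    by move=> /(_ (esym ijE)).
  by move=> /(_ fY); apply: sub_finite_set => k _; exact: Yl.
have Yact x d : Y d -> Y (lact h x d).
  move=> [u ru <-].
  have [xl|xl] := eqVneq x (linv (last y (v ++ u))); last first.
    exists (rcons u x); last by rewrite -rcons_cat wact_rcons.
    by rewrite /reduced /= -rcons_cat rcons_path; apply/andP; split.
  case/lastP: u ru xl => [|u z] ru xl.
    rewrite cats0 xl cats0 -/l -/c -{1}rc /=.
    have -> : lact h (linv l) (lact h l (iter r (lact h l) c)) = iter r (lact h l) c.
      exact: lactK.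
    exact: Yl.
  exists u.
    by move: ru; rewrite /reduced /= -rcons_cat rcons_path => /andP[].
  by rewrite xl -!rcons_cat last_rcons wact_rcons lactK.
apply: inf; apply: sub_finite_set fY => _ [w _ <-].
have Yw d z : Y d -> Y (wact h z d).
  by elim: z d => //= x z IH d /(Yact x) /IH.
rewrite -[t](wactK h (y :: v)); do 2 apply: (Yw).
by exact: (Yl 0%N).
Qed.

(** Successive extensions of one word: having left a finite set along a prefix
    is not undone by prolonging the word. *)
Lemma leave_all_finite (P : set nat) (h : nat -> 'I_n -> Aut M) (K : nat -> set T)
    (t : nat -> T) m : (0 < n)%N ->
  (forall i, P i -> finite_set (K i)) ->
  (forall i, P i -> infinite_set (word_orbit (h i) (t i))) ->
  exists v, [/\ v != [::], reduced v &
    forall i, (i < m)%N -> P i -> ~ stays (h i) (K i) (t i) v].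
Proof.
move=> n0 fK inf; elim: m => [|m [v [v0 rv vm]]].
  by exists [:: (Ordinal n0, false)].
have [Pm|nPm] := pselect (P m); last first.
  exists v; split=> // i; rewrite ltnS leq_eqVlt => /predU1P[-> //|]; exact: vm.
have [u ru nu] := leave_finite (fK _ Pm) (inf _ Pm) rv v0.
exists (v ++ u); split=> //; first by case: (v) v0.
move=> i; rewrite ltnS leq_eqVlt => /predU1P[-> //|im Pi].
by move=> /stays_cat; exact: vm.
Qed.

End leaving.

(** * The topology of tuples of automorphisms *)

Lemma ptws_nbhsP (X : topologicalType) n (h : {ptws 'I_n -> X}) A :
  nbhs h A <-> exists2 U : 'I_n -> set X, forall j, nbhs (h j) (U j) &
    forall h' : {ptws 'I_n -> X}, (forall j, U j (h' j)) -> A h'.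
Proof.
pose F := filter_from [set U : 'I_n -> set X | forall j, nbhs (h j) (U j)]
  (fun U => [set h' : {ptws 'I_n -> X} | forall j, U j (h' j)]).
have FF : Filter F.
  apply: filter_from_filter; first by exists (fun=> setT) => j; exact: filterT.
  move=> U V hU hV; exists (fun j => U j `&` V j).
    by move=> j; apply: filterI; [exact: hU|exact: hV].
  by move=> h' UV; split=> j; have [] := UV j.
have Fh : F --> h.
  apply/cvg_sup => j B [C [[W oW <-] Wh WB]].
  exists (fun i => [set y | i = j -> W y]) => [i|h' h'W].
    have [ij|ij] := eqVneq i j; last first.
      by apply: (filterS _ filterT) => y _ ij'; rewrite ij' eqxx in ij.
    rewrite ij; apply: (@filterS _ _ _ W) => [y Wy _ //|].
    exact: open_nbhs_nbhs.
  exact: (WB h' (h'W j erefl)).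
split=> [/Fh[U hU UA]|[U hU UA]]; first by exists U.
apply: (filterS UA).
apply: (@filter_forall _ _ (fun j => [set h' : {ptws 'I_n -> X} | U j (h' j)]) _
  (nbhs_filter h)) => j.
exact: (@proj_continuous _ (fun=> X) j h _ (hU j)).
Qed.

Section initial_segments.
Context {T : countType}.

(** Points enter in the order of [pickle], so the stage from which a given
    point belongs to the segment is explicit. *)
Definition tseq p : seq T := pmap unpickle (iota 0 p).

Lemma tseqP p (t : T) : t \in tseq p <-> exists2 i, (i < p)%N & unpickle i = Some t.
Proof.
rewrite mem_pmap; split=> [/mapP[i]|[i ip it]]; first by rewrite mem_iota => ip ->; exists i.
by apply/mapP; exists i; rewrite ?mem_iota.
Qed.

Lemma mem_tseq p (t : T) : (pickle t < p)%N -> t \in tseq p.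
Proof. by move=> tp; apply/tseqP; exists (pickle t) => //; exact: pickleK. Qed.

Lemma tseq_mono p q : (p <= q)%N -> {subset tseq p <= tseq q}.
Proof.
move=> pq t /tseqP[i ip it]; apply/tseqP; exists i => //.
exact: leq_trans ip pq.
Qed.

Lemma tseq_absorb (s : seq T) : exists p, {subset s <= tseq p}.
Proof.
elim: s => [|t s [p sp]]; first by exists 0%N.
exists (maxn (pickle t).+1 p) => u; rewrite inE => /predU1P[->|/sp].
  by apply: mem_tseq; rewrite leq_maxl.
exact/tseq_mono/leq_maxr.
Qed.

End initial_segments.

Section tuples.
Context {L : language} {T : countType} {M : structure L T}.
Local Notation G := (Aut M).

Definition fixer p : set G := stabilizer [set` tseq p].

Lemma fixer_subgroup p : subgroup (fixer p).
Proof.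
split=> // [x y xp yp t tp|x xp t tp]; first by rewrite autM yp// xp.
by rewrite -{1}(xp t tp) autVK.
Qed.

Lemma fixer_mono p q : (p <= q)%N -> fixer q `<=` fixer p.
Proof. by move=> pq g gq t tp; apply: gq; exact: tseq_mono tp. Qed.

Lemma aut_nbhsP (g : G) A :
  nbhs g A <-> exists p, forall g' : G, {in tseq p, forall t, g' t = g t} -> A g'.
Proof.
pose F := filter_from [set: nat]
  (fun p => [set g' : G | {in tseq p, forall t, g' t = g t}]).
have FF : Filter F.
  apply: filter_from_filter; first by exists 0%N.
  move=> p q _ _; exists (maxn p q) => // g' g'g; split=> t tp; apply: g'g.
    exact: (tseq_mono (leq_maxl _ _)).
  exact: (tseq_mono (leq_maxr _ _)).
have Fg : F --> g.
  apply/aut_cvgP => t; exists (pickle t).+1 => // g'; apply.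
  exact: mem_tseq.
split=> [/Fg[p _ pA]|[p pA]]; first by exists p.
apply: (filterS pA); elim: (tseq p) => [|t s IH].
  by apply: (filterS _ filterT).
apply: filterS2 (aut_nbhs g t) IH => g' g't g's u.
by rewrite inE => /predU1P[->|/g's].
Qed.

Lemma open_fixer p : open (fixer p).
Proof.
rewrite openE => g gp; apply/aut_nbhsP; exists p => g' g'g t tp.
by rewrite g'g//; exact: gp.
Qed.

Lemma fixer_nbhs1 A : nbhs (1%g : G) A <-> exists p, fixer p `<=` A.
Proof. exact: aut_nbhsP. Qed.

Section ntuples.
Context {n : nat}.
Implicit Types (h : {ptws 'I_n -> G}).

Definition agree p h h' := forall j t, t \in tseq p -> h' j t = h j t.

Lemma agree_trans p h h' h'' : agree p h h' -> agree p h' h'' -> agree p h h''.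
Proof. by move=> hh' h'h'' j t tp; rewrite h'h''// hh'. Qed.

Lemma agree_sym p h h' : agree p h h' -> agree p h' h.
Proof. by move=> hh' j t tp; rewrite hh'. Qed.

Lemma agree_mono p q h h' : (p <= q)%N -> agree q h h' -> agree p h h'.
Proof. by move=> pq hh' j t tp; apply: hh'; exact: tseq_mono tp. Qed.

Lemma tuple_nbhsP h A : nbhs h A <-> exists p, forall h', agree p h h' -> A h'.
Proof.
rewrite ptws_nbhsP; split=> [[U hU UA]|[p pA]].
  have /choice[q qU] j : exists p, forall g' : G,
    {in tseq p, forall t, g' t = h j t} -> U j g' by exact/aut_nbhsP.
  exists (\max_j q j) => h' hh'; apply: UA => j; apply: qU => t tq.
  by apply: hh'; apply: tseq_mono tq; exact: leq_bigmax.
exists (fun j => [set g' : G | {in tseq p, forall t, g' t = h j t}]) => [j|h' hh'].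
  by apply/aut_nbhsP; exists p.
by apply: pA => j t; exact: hh'.
Qed.

Lemma agree_nbhs p h : nbhs h (agree p h).
Proof. by apply/tuple_nbhsP; exists p. Qed.

Lemma open_agree p h : open (agree p h).
Proof.
rewrite openE => h' hh'; apply/tuple_nbhsP; exists p => h''.
exact: agree_trans.
Qed.

Lemma uniform_agree (P : T -> {ptws 'I_n -> G} -> Prop) h (s : seq T) :
  (forall t, t \in s -> exists p, forall h', agree p h h' -> P t h') ->
  exists p, forall h', agree p h h' -> forall t, t \in s -> P t h'.
Proof.
elim: s => [|t s IH] tP; first by exists 0%N.
have [|p pP] := IH; first by move=> u us; apply: tP; rewrite inE us orbT.
have [q qP] := tP t (mem_head _ _).
exists (maxn p q) => h' hh' u; rewrite inE => /predU1P[->|].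
  by apply: qP; apply: agree_mono hh'; exact: leq_maxr.
by apply: pP; apply: agree_mono hh'; exact: leq_maxl.
Qed.

(** An inverse letter at [t] reads the generator at the preimage of [t], which
    therefore has to be in the segment. *)
Lemma wact_local h w t : exists p, forall h', agree p h h' -> wact h' w t = wact h w t.
Proof.
elim: w t => [|[j b] w IH] t; first by exists 0%N.
have [p pP] := IH (lact h (j, b) t).
pose u := if b then lact h (j, b) t else t.
exists (maxn p (pickle u).+1) => h' hh'; rewrite !wact_cons.
suff -> : lact h' (j, b) t = lact h (j, b) t.
  by apply: pP; apply: agree_mono hh'; exact: leq_maxl.
have : h' j u = h j u by apply: hh'; apply: mem_tseq; exact: leq_maxr.
rewrite /u; case: (b) => // E; have ht := lactKV h (j, false) t.
by have := lactK h' (j, false) (lact h (j, true) t); rewrite lact_false E [h j _]ht.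
Qed.

Lemma open_weval (V : set G) w : open V -> open [set h : {ptws 'I_n -> G} | V (weval h w)].
Proof.
move=> oV; rewrite openE => h hV.
have /aut_nbhsP[p pV] : nbhs (weval h w) V by exact: open_nbhs_nbhs.
apply/tuple_nbhsP.
have [|q qP] := @uniform_agree (fun t h' => wact h' w t = wact h w t) h (tseq p).
  by move=> t _; exact: wact_local.
by exists q => h' hh'; apply: pV => t; exact: qP.
Qed.

End ntuples.
End tuples.

(** * Baire category *)

Section category.
Context {X : topologicalType}.

Lemma meager_countable (I : countType) (F : I -> set X) (A : set X) :
  (forall i, nowhere_dense (F i)) -> A `<=` \bigcup_i F i -> meager A.
Proof.
move=> nF AF; exists (fun k => if unpickle k is Some i then F i else set0).
  move=> k; case: unpickle => // ; rewrite /nowhere_dense closure0.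
  by apply/seteqP; split=> // x /nbhs_singleton.
by move=> x /AF[i _ Fx]; exists (pickle i) => //; rewrite pickleK.
Qed.

Lemma nowhere_dense_closed_open (C U : set X) : closed C -> open U ->
  (forall x : X, ~ nbhs x (C `&` U)) -> nowhere_dense (C `&` U).
Proof.
move=> cC oU nCU; apply/seteqP; split=> // y yi.
have yc : closure (C `&` U) y by exact: nbhs_singleton.
have [x [[Cx Ux] xi]] := yc _ (nbhs_interior yi).
apply: (nCU x); apply: filterI; last exact: open_nbhs_nbhs.
apply: filterS xi => z zc; apply: cC => B /zc[u [[Cu _] Bu]].
by exists u.
Qed.

Lemma nowhere_dense_setC (U : set X) : open U ->
  (forall (x : X) A, nbhs x A -> exists2 y, A y & U y) -> nowhere_dense (~` U).
Proof.
move=> oU dU; rewrite -[~` U]setIT; apply: nowhere_dense_closed_open.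
- exact: open_closedC.
- exact: openT.
- by move=> x /dU[y []].
Qed.

End category.

Section limits.
Context {L : language} {T : countType} {M : structure L T} {n : nat}.
Local Notation G := (Aut M).

Lemma automorphism_local (f : T -> T) :
  (forall s : seq T, exists g : G, {in s, forall t, f t = g t}) ->
  (forall t, exists u, f u = t) -> automorphism M f.
Proof.
move=> fg fsurj; have finj : injective f.
  move=> t u; have [g gE] := fg [:: t; u].
  by rewrite !gE ?inE ?eqxx ?orbT//; exact: aut_inj.
have mapE k (t : k.-tuple T) (g : G) : {in t, forall u, f u = g u} ->
    map_tuple f t = map_tuple g t.
  by move=> tE; apply: val_inj; apply/eq_in_map.
split=> [|s t|r t].
- have [f' f'K] := choice fsurj.
  by exists f' => // t; apply: finj.
- have [g gE] := fg (func_interp M t :: t).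
  rewrite gE ?mem_head// (mapE _ _ g) => [|u ut]; last by rewrite gE// inE ut orbT.
  by have [_ -> _] := autP g.
- have [g gE] := fg t; rewrite (mapE _ _ g)//.
  by have [_ _] := autP g; apply.
Qed.

(** Finite approximations are refined so as to avoid the [k]-th nowhere dense
    set at step [k], and so that the preimages of the first [k] points are
    fixed, which makes the limit surjective. *)
Theorem Baire_tuples (A : set {ptws 'I_n -> G}) : meager A ->
  forall (h : {ptws 'I_n -> G}) p, exists2 h', agree p h h' & ~ A h'.
Proof.
move=> [F nF AF] h p.
have step (k : nat) (x : {ptws 'I_n -> G} * nat) :
    exists y : {ptws 'I_n -> G} * nat, [/\ agree x.2 x.1 y.1, (x.2 < y.2)%N,
      forall h', agree y.2 y.1 h' -> ~ F k h' &
      forall j t, t \in tseq k -> (aut_inv (y.1 j) : G) t \in tseq y.2].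
  case: x => h0 q; have [h1 h01 h1F] : exists2 h1, agree q h0 h1 & ~ closure (F k) h1.
    apply: contrapT => nh1; suff : interior (closure (F k)) h0 by rewrite nF.
    apply/tuple_nbhsP; exists q => h1 h01; apply: contrapT => nc.
    by apply: nh1; exists h1.
  have [r rF] : exists r, forall h', agree r h1 h' -> ~ F k h'.
    apply/tuple_nbhsP; have : nbhs h1 (~` closure (F k)).
      by apply: open_nbhs_nbhs; split=> //; exact/closed_openC/closed_closure.
    by apply: filterS => h'; apply: contra_not; exact: subset_closure.
  have [m sm] := tseq_absorb
    [seq (aut_inv (h1 j) : G) t | j <- enum 'I_n, t <- tseq k].
  exists (h1, maxn (maxn q.+1 r) m); split=> //=.
  - by rewrite !leq_max leqnn.
  - by move=> h' h1h'; apply: rF; apply: agree_mono h1h'; rewrite !leq_max leqnn orbT.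
  - move=> j t tk; apply: (tseq_mono (leq_maxr _ _)); apply: sm.
    by apply/allpairsP; exists (j, t); rewrite mem_enum.
have /choice[next nextP] : forall kx : nat * ({ptws 'I_n -> G} * nat), exists y, _ :=
  fun kx => step kx.1 kx.2.
pose s := fix s k := if k is k'.+1 then next (k', s k') else (h, p).
have sP k := nextP (k, s k).
have s_ge k : (k <= (s k).2)%N.
  by elim: k => // k IH; have [_ + _ _] := sP k; apply: leq_ltn_trans.
have s_mono k m : (k <= m)%N -> agree (s k).2 (s k).1 (s m).1 /\ ((s k).2 <= (s m).2)%N.
  elim: m => [|m IH]; first by rewrite leqn0 => /eqP ->.
  rewrite leq_eqVlt => /predU1P[-> //|]; rewrite ltnS => /IH[km kmle].
  have [sm smle _ _] := sP m; split; last exact: leq_trans kmle (ltnW smle).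
  by apply: agree_trans km _; exact: agree_mono sm.
pose f j t := ((s (pickle t).+1).1 j : G) t.
have fE j k t : (pickle t < k)%N -> f j t = ((s k).1 j : G) t.
  move=> tk; have [sE _] := s_mono _ _ tk; rewrite sE//.
  by apply: mem_tseq; exact: s_ge.
have fE' j k t : t \in tseq (s k).2 -> f j t = ((s k).1 j : G) t.
  move=> tk; rewrite (fE j (maxn k (pickle t).+1)) ?leq_maxr//.
  by have [sE _] := s_mono _ _ (leq_maxl k (pickle t).+1); rewrite sE.
have fA j : automorphism M (f j).
  apply: automorphism_local => [r|t].
    have [k rk] := tseq_absorb r; exists ((s k).1 j) => t /rk tk.
    by apply: fE'; exact: tseq_mono (s_ge k) _ tk.
  have [_ _ _ sV] := sP (pickle t).+1; have tV := sV j t (mem_tseq (ltnSn _)).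
  by exists (aut_inv ((s (pickle t).+2).1 j) t); rewrite (fE' j (pickle t).+2 _ tV) aut_invKV.
exists (fun j => aut_mk (fA j)) => [j t tp|/AF[k _]].
  by rewrite aut_mkE (fE' j 0%N).
have [_ _ + _] := sP k; apply => j t tk.
by rewrite aut_mkE; exact: (fE' j k.+1).
Qed.

End limits.

(** * Non-precompact and non-discrete subgroups *)

Lemma ultra_finite_const (X : Type) (Y : eqType) (F : set_system X)
    (phi : X -> Y) (S : set Y) :
  UltraFilter F -> finite_set S -> F [set x | S (phi x)] ->
  exists c, F [set x | phi x = c].
Proof.
move=> FU /finite_seqP[s ->]; elim: s => [|a s IH] Fs.
  by have [x] := @filter_ex _ F _ _ Fs.
have [Fa|Fna] := in_ultra_setVsetC [set x | phi x = a] FU; first by exists a.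
apply: IH; apply: filterS2 Fs Fna => x /=.
by rewrite inE => /predU1P[].
Qed.

Section subgroups.
Context {L : language} {T : countType} {M : structure L T} {n : nat}.
Local Notation G := (Aut M).

(** If all orbits are finite, an ultrafilter on the closure is eventually
    constant at each point, for the automorphisms as for their inverses, so
    it converges to an automorphism. *)
Lemma infinite_orbit (h : {ptws 'I_n -> G}) :
  ~ precompact_set (tuple_group h) -> exists t, infinite_set (word_orbit h t).
Proof.
move=> npc; apply: contrapT => nt; apply: npc.
have fO t : finite_set (word_orbit h t) by apply: contrapT => it; apply: nt; exists t.
have clP (g : G) t : closure (tuple_group h) g -> exists w, g t = wact h w t.
  move=> /(_ _ (aut_nbhs g t))[_ [/tuple_groupP[w ->] /= wt]].
  by exists w.
rewrite /precompact_set compact_ultra => F FU Fcl.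
have /choice[c cP] t : exists c, F [set g : G | g t = c].
  apply: (ultra_finite_const FU (fO t)); apply: filterS Fcl => g /=.
  by by move=> /(clP _ t)[w gt] /=; rewrite gt; exists w.
have /choice[d dP] t : exists d, F [set g : G | aut_inv g t = d].
  apply: (ultra_finite_const FU (fO t)); apply: filterS Fcl => g /=.
  move=> /(clP _ (aut_inv g t))[w]; rewrite aut_invKV => tE /=.
  exists (winv w) => //; rewrite {1}tE; exact: wactK.
have Fs (s : seq T) : F [set g : G | {in s, forall t, c t = g t}].
  elim: s => [|t s IH]; first by apply: filterS filterT.
  apply: filterS2 (cP t) IH => g /= gt gs u.
  by rewrite inE => /predU1P[->|/gs].
have cA : automorphism M c.
  apply: automorphism_local => [s|t].
    exact: (@filter_ex _ F _ _ (Fs s)).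
  have [g [/= gd gc]] := @filter_ex _ F _ _ (filterI (dP t) (Fs [:: d t])).
  by exists (d t); rewrite gc ?mem_head// -gd aut_invKV.
have Fc : F --> aut_mk cA by apply/aut_cvgP => t; apply: filterS (cP t).
exists (aut_mk cA); split=> //.
exact: (@closed_cvg _ _ F _ id (closure (tuple_group h)) (@closed_closure _ _) Fcl).
Qed.

(** Otherwise the identity would be isolated in the subgroup, hence, by
    translation, so would every element. *)
Lemma small_words (h : {ptws 'I_n -> G}) p :
  ~ discrete_set (tuple_group h) ->
  exists w, [/\ w != [::], reduced w & fixer p (weval h w)].
Proof.
move=> nd; apply: contrapT => nw; apply: nd => U.
have triv (x : G) : tuple_group h x -> fixer p x -> x = 1%g.
  move=> /tuple_groupP[w ->]; have [u ru <-] := reduced_wordP h w.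
  by case: u ru => // l u ru xp; exfalso; apply: nw; exists (l :: u).
exists [set g : G | exists2 x : set_type (tuple_group h), U x &
    {in tseq p, forall t, g t = (set_val x : G) t}].
  rewrite openE => g [x Ux gx]; apply/aut_nbhsP; exists p => g' g'g.
  by exists x => // t tp; rewrite g'g// gx.
apply/seteqP; split=> [x [y Uy xy]|x Ux]; last by exists x.
suff -> : x = y by [].
apply: val_inj; apply: (mulgI (set_val y)^-1%g); rewrite [RHS]mulVg.
have [_ SM SV] := subgroup_tuple_group h.
apply: triv => [|t tp]; last by rewrite autM xy// autVK.
by apply: SM; [apply: SV|]; apply: set_valP.
Qed.

End subgroups.

(** * Tuples of random automorphisms *)

Section random_automorphisms.
Context d (X : measurableType d) (R : realType) (P : probability X R).
Context {L : language} {T : countType} {M : structure L T} {n : nat}.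
Local Notation G := (Aut M).
Local Notation H := (L0 P G).
Implicit Types (f : H) (g : {ptws 'I_n -> H}) (h : {ptws 'I_n -> G}).

Lemma ae_le_measure (A B : set X) : measurable A -> measurable B ->
  (\forall x \ae P, A x -> B x) -> (P A <= P B)%E.
Proof.
move=> mA mB AB; rewrite -[leRHS]adde0 -(measure0 P).
by apply: ae_le_measureU => //; apply: filterS AB => x AB Ax; left; exact: AB.
Qed.

Lemma lt_measure_bigcup (F : (set X)^nat) (c : \bar R) :
  (forall i, measurable (F i)) -> {homo F : i j / (i <= j)%N >-> (i <= j)%O} ->
  (c < P (\bigcup_i F i))%E -> exists i, (c < P (F i))%E.
Proof.
move=> mF ndF cF; apply: contrapT => nF; move: cF; rewrite ltNge => /negP; apply.
have cvgF := nondecreasing_cvg_mu (mu := P) mF (bigcupT_measurable _ mF) ndF.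
rewrite -(cvg_lim _ cvgF)//; apply: lime_le; first by apply/cvg_ex; eexists; exact: cvgF.
by apply: nearW => i /=; rewrite leNgt; apply/negP => ci; apply: nF; exists i.
Qed.

Definition values g (x : X) : {ptws 'I_n -> G} := fun j => g j x.

Lemma ae_weval g w :
  \forall x \ae P, L0_fun (weval g w) x = weval (values g x) w.
Proof.
elim: w => [|[j b] w IH]; first exact: L0_oneE.
have E1 := L0_mulE (weval g w) (leval g (j, b)); have E2 := L0_invE (g j).
near=> x; rewrite /= (near E1 x)// (near IH x)//; congr (_ * _)%g.
by rewrite /leval; case: (b) => //=; rewrite (near E2 x).
Unshelve. all: by end_near. Qed.

Lemma agree_fixer p h h' : agree p h h' <-> forall j, fixer p ((h j)^-1 * h' j)%g.
Proof.
split=> [hh' j t tp|hh' j t tp]; first by rewrite autM hh'// autVK.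
by rewrite -{2}(hh' j t tp) autM autKV.
Qed.

Lemma measurable_agree p (u v : X -> {ptws 'I_n -> G}) :
  (forall j, measurable_fun [set: X] ((fun x => u x j) : X -> borel G)) ->
  (forall j, measurable_fun [set: X] ((fun x => v x j) : X -> borel G)) ->
  measurable [set x | agree p (u x) (v x)].
Proof.
move=> mu mv; rewrite (_ : [set _ | _] =
    \bigcap_(j in [set: 'I_n]) ((fun x => (u x j)^-1 * v x j)%g @^-1` fixer p)); last first.
  apply/seteqP; split=> x /=; first by move=> /agree_fixer uv j _; exact: uv.
  by move=> uv; apply/agree_fixer => j; exact: (uv j).
apply: fin_bigcap_measurable => // j _.
have /borel_measurableP := measurable_mulg (measurable_invg (mu j)) (mv j).
by apply; exact: open_fixer.
Qed.

Lemma measurable_values g j :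
  measurable_fun [set: X] ((fun x => values g x j) : X -> borel G).
Proof. exact: measurable_L0. Qed.

(** The type of snapshots is countable, which reduces measurability of events
    to that of agreement with a fixed tuple. *)
Definition snapshot p h : {ffun 'I_n -> seq T} := [ffun j => map (h j : G) (tseq p)].

Lemma snapshotP p h h' : snapshot p h = snapshot p h' <-> agree p h h'.
Proof.
split=> [/ffunP E j t tp|hh'].
  by have := E j; rewrite !ffunE => /eq_in_map -> //.
by apply/ffunP => j; rewrite !ffunE; apply/eq_in_map => t tp; rewrite hh'.
Qed.

Lemma snapshot_rep : exists rep : nat -> {ffun 'I_n -> seq T} -> {ptws 'I_n -> G},
  forall p h, agree p h (rep p (snapshot p h)).
Proof.
have /choice[rep repP] : forall pc : nat * {ffun 'I_n -> seq T},
    exists r : {ptws 'I_n -> G}, forall h, snapshot pc.1 h = pc.2 -> agree pc.1 h r.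
  move=> [p c]; have [[r rc]|nr] := pselect (exists r, snapshot p r = c).
    by exists r => h hc; apply/snapshotP; rewrite hc.
  by exists (fun=> 1%g) => h hc; case: nr; exists h.
by exists (fun p c => rep (p, c)) => p h; exact: (repP (p, snapshot p h)).
Qed.

Lemma measurable_open_values (O : set {ptws 'I_n -> G}) g : open O ->
  measurable [set x | O (values g x)].
Proof.
move=> oO; have [rep repP] := snapshot_rep.
pose D := [set pc : nat * {ffun 'I_n -> seq T} | agree pc.1 (rep pc.1 pc.2) `<=` O].
rewrite (_ : [set _ | _] =
    \bigcup_(pc in D) [set x | agree pc.1 (rep pc.1 pc.2) (values g x)]); last first.
  apply/seteqP; split=> [x /= Ox|x [pc Dpc]]; last exact: Dpc.
  have /tuple_nbhsP[p pO] : nbhs (values g x) O by exact: open_nbhs_nbhs.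
  exists (p, snapshot p (values g x)) => /=; last exact/agree_sym/repP.
  by move=> h; rewrite /= => rh; apply: pO; apply: agree_trans rh; exact: repP.
apply: bigcup_countable_measurable; first exact: countableP.
move=> pc _; apply: measurable_agree => j; last exact: measurable_values.
exact: measurable_cst.
Qed.

Lemma measurable_disagree p g (v : X -> {ptws 'I_n -> G}) :
  (forall j, measurable_fun [set: X] ((fun x => v x j) : X -> borel G)) ->
  measurable [set x | ~ agree p (values g x) (v x)].
Proof.
by move=> mv; apply: measurableC; apply: measurable_agree => // j; exact: measurable_values.
Qed.

End random_automorphisms.

Local Open Scope ring_scope.

Section random_topology.
Context d (X : measurableType d) (R : realType) (P : probability X R).
Context {L : language} {T : countType} {M : structure L T} {n : nat}.
Local Notation G := (Aut M).
Local Notation H := (L0 P G).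
Implicit Types (f : H) (g : {ptws 'I_n -> H}) (h : {ptws 'I_n -> G}).

Lemma measurable_not_fixer (u v : X -> G) p :
  measurable_fun [set: X] (u : X -> borel G) ->
  measurable_fun [set: X] (v : X -> borel G) ->
  measurable [set x | ~ fixer p ((u x)^-1 * v x)%g].
Proof.
move=> mu mv; apply: measurableC.
have /borel_measurableP := measurable_mulg (measurable_invg mu) mv.
by apply; exact: open_fixer.
Qed.

Lemma ae_mulg (f k : H) : \forall x \ae P, L0_fun (f * k)%g x = (f x * k x)%g.
Proof. exact: L0_mulE. Qed.

Lemma ae_mulVg (f k : H) : \forall x \ae P, L0_fun (f^-1 * k)%g x = ((f x)^-1 * k x)%g.
Proof.
have E1 := ae_mulg f^-1%g k; have E2 := L0_invE f.
by near=> x; rewrite (near E1 x)// [L0_fun _ x](near E2 x).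
Unshelve. all: by end_near. Qed.

(** There are finitely many coordinates, so one segment and one bound serve for
    all of them. *)
Lemma tuple_L0_nbhsP g A : nbhs g A <-> exists p (e : R), 0 < e /\
  forall g', (P [set x | ~ agree p (values g x) (values g' x)] < e%:E)%E -> A g'.
Proof.
split=> [/ptws_nbhsP[U gU UA]|[p [e [e0 peA]]]].
  have /choice[q qU] j : exists pe : nat * R, 0 < pe.2 /\
      forall f, (P [set x | ~ fixer pe.1 ((g j x)^-1 * f x)%g] < pe.2%:E)%E -> U j f.
    have [[V e] [/= [oV V1] e0] VU] := gU j.
    have /fixer_nbhs1[p pV] : nbhs (1%g : G) V by exact: open_nbhs_nbhs.
    exists (p, e); split=> //= f fe; apply: VU; exists ((g j)^-1 * f)%g; last exact: mulVKg.
    rewrite /L0_nbhd1 /=; apply: le_lt_trans fe; apply: ae_le_measure.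
    - exact: measurable_notin.
    - by apply: measurable_not_fixer; exact: measurable_L0.
    by apply: filterS (ae_mulVg (g j) f) => x /= ->; apply: contra_not => /pV.
  exists (\max_j (q j).1), (\big[Num.min/1]_j (q j).2); split.
    by apply/bigmin_gtP; split=> // j _; have [] := qU j.
  move=> g' g'g; apply: UA => j; have [_] := qU j; apply.
  apply: (@lt_le_trans _ _ (\big[Num.min/1]_j (q j).2)%:E); last first.
    by rewrite lee_fin; exact: bigmin_le.
  apply: le_lt_trans g'g; apply: le_measure; rewrite ?inE.
  - by apply: measurable_not_fixer; exact: measurable_L0.
  - by apply: measurable_disagree => i; exact: measurable_values.
  move=> x /=; apply: contra_not => /agree_fixer/(_ j); apply: fixer_mono.
  exact: leq_bigmax.
apply: (filterS peA).
pose B (s : seq 'I_n) (g' : {ptws 'I_n -> H}) := [set x | exists2 j, j \in s & ~ fixer p ((g j x)^-1 * g' j x)%g].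
have mB s g' : measurable (B s g').
  rewrite (_ : B s g' = \bigcup_(j in [set` s])
      [set x | ~ fixer p ((g j x)^-1 * g' j x)%g]); last first.
    by apply/seteqP; split=> x [j js jx]; exists j.
  apply: fin_bigcup_measurable => // j _.
  by apply: measurable_not_fixer; exact: measurable_L0.
suff S s (c : R) : 0 < c -> nbhs g [set g' : {ptws 'I_n -> H} | (P (B s g') < c%:E)%E].
  have := S (enum 'I_n) e e0; apply: filterS => g' /=; apply: le_lt_trans.
  apply: le_measure; rewrite ?inE//.
    by apply: measurable_disagree => i; exact: measurable_values.
  move=> x /= ng; apply: contrapT => nB; apply: ng; apply/agree_fixer => j.
  by apply: contrapT => jx; apply: nB; exists j => //; rewrite mem_enum.
elim: s c => [|j s IH] c c0.
  apply: filterS filterT => g' _ /=; rewrite (_ : B [::] g' = set0) ?measure0//.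
  by apply/seteqP; split=> x // [].
have c20 : 0 < c / 2 by rewrite divr_gt0.
have gj : nbhs g [set g' : {ptws 'I_n -> H} | (P [set x | ~ fixer p ((g j x)^-1 * g' j x)%g] < (c / 2)%:E)%E].
  apply: (@proj_continuous _ (fun=> H) j g
    [set f : H | (P [set x | ~ fixer p ((g j x)^-1 * f x)%g] < (c / 2)%:E)%E]).
  exists (fixer p, c / 2) => /=.
    split=> //; split; first exact: open_fixer.
    by have [] := fixer_subgroup (M := M) p.
  move=> _ [k kp <-]; apply: le_lt_trans kp; apply: ae_le_measure.
  - by apply: measurable_not_fixer; exact: measurable_L0.
  - by apply: measurable_notin; exact: open_fixer.
  by apply: filterS (ae_mulg (g j) k) => x /= ->; rewrite mulKg.
apply: filterS2 gj (IH _ c20) => g' /= jc sc.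
apply: (@le_lt_trans _ _ (P [set x | ~ fixer p ((g j x)^-1 * g' j x)%g] + P (B s g'))%E).
  apply: (@le_trans _ _ (P ([set x | ~ fixer p ((g j x)^-1 * g' j x)%g] `|` B s g'))).
    apply: le_measure; rewrite ?inE//.
      by apply: measurableU => //; apply: measurable_not_fixer; exact: measurable_L0.
    by move=> x [i]; rewrite inE => /predU1P[->|si ix]; [left|right; exists i].
  by apply: measureU2 => //; apply: measurable_not_fixer; exact: measurable_L0.
by rewrite [c]splitr EFinD; exact: lteD.
Qed.

(** By continuity from below, the bound already holds for the event that [O]
    contains all tuples agreeing with the value on some fixed segment; this
    event is changed on a small set only by a small perturbation. *)
Lemma open_measure_gt (O : set {ptws 'I_n -> G}) (c : R) : open O ->
  open [set g : {ptws 'I_n -> H} | (c%:E < P [set x | O (values g x)])%E].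
Proof.
move=> oO; rewrite openE => g /= cg.
pose Oq q : set {ptws 'I_n -> G} := [set h | forall h', agree q h h' -> O h'].
have oOq q : open (Oq q).
  rewrite openE => h hO; apply/tuple_nbhsP; exists q => h' hh' h'' h'h''.
  by apply: hO; apply: agree_trans h'h''.
have [q cq] : exists q, (c%:E < P [set x | Oq q (values g x)])%E.
  apply: (lt_measure_bigcup (F := fun q => [set x | Oq q (values g x)])).
  - by move=> q; exact: measurable_open_values.
  - move=> p q pq; apply/subsetPset => x gp h' hh'; apply: gp; exact: agree_mono hh'.
  apply: lt_le_trans cg _; apply: le_measure; rewrite ?inE.
  - exact: measurable_open_values.
  - by apply: bigcupT_measurable => q; exact: measurable_open_values.
  move=> x /= Ox; have /tuple_nbhsP[q qO] : nbhs (values g x) O by exact: open_nbhs_nbhs.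
  by exists q.
pose m := fine (P [set x | Oq q (values g x)]).
have mE : P [set x | Oq q (values g x)] = m%:E.
  by rewrite fineK//; apply: fin_num_measure; exact: measurable_open_values.
apply/tuple_L0_nbhsP; exists q, (m - c); split.
  by rewrite subr_gt0 -lte_fin -mE.
move=> g' g'g; rewrite /=.
have mD : measurable [set x | ~ agree q (values g x) (values g' x)].
  by apply: measurable_disagree => i; exact: measurable_values.
have mO' := measurable_open_values (P := P) g' oO.
have : (m%:E <= P [set x | O (values g' x)] +
    P [set x | ~ agree q (values g x) (values g' x)])%E.
  rewrite -mE; apply: le_trans (measureU2 _ mO' mD).
  apply: le_measure; rewrite ?inE; [exact: measurable_open_values|exact: measurableU|].
  move=> x /= gq; have [ag|] := pselect (agree q (values g x) (values g' x)); last by right.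
  by left; exact: gq.
move: g'g; rewrite -(fineK (fin_num_measure P _ mD)) -(fineK (fin_num_measure P _ mO')).
by rewrite -EFinD !lte_fin lee_fin; lra.
Qed.

(** There are countably many snapshots, so finitely many of them account for
    all but a small part of the space. A neighbourhood only sees snapshots, so
    the value on each piece can be replaced by any tuple with the same one. *)
Lemma step_approx g A : nbhs g A ->
  exists N (phi : X -> nat) (h : nat -> {ptws 'I_n -> G}) p,
    (forall x, (phi x < N)%N) /\
    (forall h' : nat -> {ptws 'I_n -> G}, (forall i, agree p (h i) (h' i)) ->
       exists2 g', A g' & \forall x \ae P, values g' x = h' (phi x)).
Proof.
move=> /tuple_L0_nbhsP[p [e [e0 peA]]].
have [rep repP] := snapshot_rep (M := M) (n := n).
pose col x := pickle (snapshot p (values g x)).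
have mcol i : measurable [set x | col x = i].
  rewrite (_ : [set _ | _] = [set x | [set h | pickle (snapshot p h) = i] (values g x)])//.
  apply: measurable_open_values; rewrite openE => h hi; apply/tuple_nbhsP; exists p => h' hh'.
  by rewrite /= -hi; congr pickle; apply/snapshotP/agree_sym.
have mltcol k : measurable [set x | (col x < k)%N].
  rewrite (_ : [set _ | _] = \bigcup_(i in `I_k) [set x | col x = i]); last first.
    by apply/seteqP; split=> [x xk|x [i /= ik ->]] //; exists (col x).
  by apply: fin_bigcup_measurable.
have [k kP] : exists k, (P (~` [set x | (col x < k)%N]) < e%:E)%E.
  have [|||k kP] := @lt_measure_bigcup _ X R P (fun k => [set x | (col x < k)%N]) (1 - e)%:E.
  - exact: mltcol.
  - by move=> i j ij; apply/subsetPset => x /leq_trans; apply.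
  - rewrite (_ : \bigcup_i _ = setT) ?probability_setT ?lte_fin; last first.
      by apply/seteqP; split=> // x _; exists (col x).+1 => //=.
    by lra.
  exists k; move: kP; rewrite probability_setC//.
  by rewrite -(fineK (fin_num_measure P _ (mltcol k))) -EFinB !lte_fin; lra.
(* All snapshots of rank at least [k] share the last piece. *)
pose phi x := minn (col x) k.
have mphi i : measurable [set x | phi x = i].
  have [ik|ki|->] := ltngtP i k.
  - rewrite (_ : [set _ | _] = [set x | col x = i])//.
    by apply/seteqP; split=> x /=; rewrite /phi; lia.
  - rewrite (_ : [set _ | _] = set0)//.
    by apply/seteqP; split=> x //=; rewrite /phi; lia.
  - rewrite (_ : [set _ | _] = ~` [set x | (col x < k)%N]); first exact: measurableC.
    by apply/seteqP; split=> x /=; rewrite /phi; lia.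
pose h i := if unpickle i is Some c then rep p c else (fun=> 1%g).
exists k.+1, phi, h, p; split=> // [x|h' hh']; first by rewrite ltnS geq_minr.
have mh' j : measurable_fun [set: X] ((fun x => h' (phi x) j) : X -> borel G).
  apply/borel_measurableP => V _.
  rewrite (_ : _ @^-1` V = \bigcup_(i in [set i | V (h' i j)]) [set x | phi x = i]).
    by apply: bigcup_countable_measurable => // i _.
  by apply/seteqP; split=> [x Vx|x [i /= Vi xi]]; [exists (phi x)|rewrite /= xi].
pose g' : {ptws 'I_n -> H} := fun j => L0_class P (mh' j).
have g'E : \forall x \ae P, values g' x = h' (phi x).
  have : \forall x \ae P, forall j, L0_fun (g' j) x = h' (phi x) j.
    by apply: filter_forall => j; exact: L0_classE.
  by apply: filterS => x xE; apply/funext => j; rewrite -xE.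
exists g' => //; apply: peA; apply: le_lt_trans kP; apply: ae_le_measure.
- by apply: measurable_disagree => i; exact: measurable_values.
- exact: measurableC.
apply: filterS g'E => x xE /=; rewrite xE; apply: contra_not => xk.
rewrite /phi (minn_idPl (ltnW xk)); apply: agree_trans (hh' _).
by rewrite /h pickleK; exact: repP.
Qed.

End random_topology.

(** * Topological similarity classes are meager *)

(** A similarity between [f] and [g] maps the value of a word at [f] to its
    value at [g], so both tuples induce the same topology on words. *)
Lemma similar_nbhs (G : preTopologicalGroupType) n (f g : {ptws 'I_n -> G}) :
  topologically_similar f g -> forall A : set G, nbhs 1%g A ->
  (exists2 B : set G, nbhs 1%g B & forall w, B (weval f w) -> A (weval g w)) /\
  (exists2 B : set G, nbhs 1%g B & forall w, B (weval g w) -> A (weval f w)).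
Proof.
move=> [phi [psi [[phiB psiA psiK phiK] phiM cphi cpsi phif]]] A A1.
have sub (h : {ptws 'I_n -> G}) w : tuple_group h (weval h w).
  by apply/tuple_groupP; exists w.
have phi1 : phi 1%g = 1%g.
  apply: (mulgI (phi 1%g)); rewrite -phiM ?mulg1//; exact: (sub f [::]).
have phiw w : phi (weval f w) = weval g w.
  elim: w => [|l w IH] //=.
  have fl : tuple_group f (leval f l) by rewrite -[leval _ _]mul1g; exact: (sub f [:: l]).
  rewrite phiM// IH; congr (_ * _)%g; case: l fl => j [] fl; last exact: phif.
  rewrite /leval /=; apply: (mulgI (g j)); rewrite mulgV -phif -phiM ?mulgV//.
  by rewrite -[f j]mul1g; exact: (sub f [:: (j, false)]).
have psiw w : psi (weval g w) = weval f w by rewrite -phiw psiK.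
have psi1 : psi 1%g = 1%g by exact: (psiw [::]).
split.
- exists [set x | tuple_group f x -> A (phi x)] => [|w]; last first.
    by move=> /(_ (sub f w)); rewrite phiw.
  have /subspace_continuousP/(_ 1%g (sub f [::]) A) := cphi.
  by apply; rewrite -phi1 in A1.
- exists [set x | tuple_group g x -> A (psi x)] => [|w]; last first.
    by move=> /(_ (sub g w)); rewrite psiw.
  have /subspace_continuousP/(_ 1%g (sub g [::]) A) := cpsi.
  by apply; rewrite -psi1 in A1.
Qed.

Section main.
Context d (X : measurableType d) (R : realType) (P : probability X R).
Context {L : language} {T : countType} {M : structure L T} {n : nat}.
Local Notation G := (Aut M).
Local Notation H := (L0 P G).
Implicit Types (g : {ptws 'I_n -> H}) (h : {ptws 'I_n -> G}).

Lemma closed_measure_le (O : set {ptws 'I_n -> G}) (c : R) : open O ->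
  closed [set g : {ptws 'I_n -> H} | (P [set x | O (values g x)] <= c%:E)%E].
Proof.
move=> oO; rewrite (_ : [set _ | _] =
  ~` [set g : {ptws 'I_n -> H} | (c%:E < P [set x | O (values g x)])%E]).
  exact/open_closedC/open_measure_gt.
by apply/seteqP; split=> g /=; rewrite leNgt => /negP.
Qed.

Lemma open_not_fixer p : open (~` @fixer L T M p).
Proof.
rewrite openE => g ng; apply/aut_nbhsP; exists p => g' g'g g'p; apply: ng => t tp.
by rewrite -g'g// g'p.
Qed.

Lemma fixer_exp p (x : G) k : fixer p x -> fixer p (x ^+ k)%g.
Proof.
move=> xp; have [f1 fM _] := fixer_subgroup (M := M) p.
by elim: k => [|k IH] //; rewrite expgS; exact: fM.
Qed.

(** In the topology on words induced by the members of a non-meager similarity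
    class, every neighbourhood of the identity contains one of these sets. *)
Definition nearly_trivial q h : set (seq (letter n)) :=
  [set w | exists2 h', agree q h h' & fixer q (weval h' w)].

Lemma nearly_trivial_agree q h h' : agree q h h' ->
  nearly_trivial q h `<=` nearly_trivial q h'.
Proof.
by move=> hh' w [k hk kw]; exists k => //; apply: agree_trans hk; exact: agree_sym.
Qed.

Definition infinite_orbit_in p : set {ptws 'I_n -> G} :=
  [set h | exists2 t, t \in tseq p & infinite_set (word_orbit h t)].

(** Tuples are dense near such an [h] that have an infinite orbit starting in
    the [p]-th segment. Non-precompactness alone gives no bound on where an
    infinite orbit starts; this open condition does. *)
Definition mostly_infinite p := interior (closure (infinite_orbit_in p)).

Lemma infinite_orbit_in_mono p q : (p <= q)%N ->
  infinite_orbit_in p `<=` infinite_orbit_in q.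
Proof. by move=> pq h [t tp it]; exists t => //; exact: tseq_mono tp. Qed.

Lemma mostly_infinite_mono p q : (p <= q)%N -> mostly_infinite p `<=` mostly_infinite q.
Proof.
move=> pq h; rewrite /mostly_infinite /interior /=; apply: filterS.
exact/closure_subset/infinite_orbit_in_mono.
Qed.

Section generic.
Context (facl : forall A : set T, finite_set A -> finite_set (acl M A)).
Context (n0 : (0 < n)%N).
Context (hdense : exists h : {ptws 'I_n -> G}, dense (diagonal_class h)).
Context (hgood : comeager [set h : {ptws 'I_n -> G} |
    ~ precompact_set (tuple_group h) /\ ~ discrete_set (tuple_group h)]).

Lemma good_near h p : exists2 h', agree p h h' &
  ~ precompact_set (tuple_group h') /\ ~ discrete_set (tuple_group h').
Proof.
by have [h' hh' /contrapT good] := Baire_tuples hgood h p; exists h'.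
Qed.

(** One word has to serve for all the tuples [h i]. A common reduced [v] first
    leads a point of each of them out of the algebraic closure of the part
    where they must be kept. The word is obtained from one that is trivial on a
    large segment, by conjugation or powers, so as to be reduced and begin with
    [v]; the [h i] are then modified along it by [escape]. *)
Lemma moving_word p q r h0 (B : set nat) (h : nat -> {ptws 'I_n -> G}) N :
  (forall i, B i -> infinite_orbit_in p (h i)) ->
  exists2 w, nearly_trivial q h0 w &
    exists2 h' : nat -> {ptws 'I_n -> G}, (forall i, agree r (h i) (h' i)) &
      forall i, (i < N)%N -> B i -> ~ fixer p (weval (h' i) w).
Proof.
move=> hB; have /choice[t tP] i : exists t, B i -> t \in tseq p /\ infinite_set (word_orbit (h i) t).
  have [Bi|nBi] := pselect (B i); first by have [t tp it] := hB _ Bi; exists t.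
  have [h' _ [/infinite_orbit[b _] _]] := good_near h0 0.
  by exists b.
(* Both ends of the edges to be kept are put in [F i]. *)
pose F i := [set` t i :: tseq r ++ [seq (h i j : G) s | j <- enum 'I_n, s <- tseq r]].
pose K i := acl M (F i).
have fK i : finite_set (K i) by apply: facl; exact: finite_seq.
have [v [v0 rv vst]] := @leave_all_finite _ _ M n B h K t N n0 (fun i _ => fK i)
  (fun i Bi => (tP i Bi).2).
have [hs h0s [_ nd]] := good_near h0 q.
(* With [q'] so large, the conjugates by [v ++ [:: x]] of a word that is
   trivial on the segment [q'] are trivial on the segment [q]. *)
have [q' q'P] := tseq_absorb (tseq q ++
  [seq wact hs (v ++ [:: x]) s | x <- enum {: letter n}, s <- tseq q]).
have [z [z0 rz zq']] := small_words q' nd.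
have zq : fixer q (weval hs z).
  by move=> s sq; apply: zq'; apply: q'P; rewrite mem_cat sq.
have [w rw wP] := reduced_prefix v0 rv z0 rz.
exists (v ++ w).
  exists hs => //; case: wP => [[x ->]|[k /(_ _ hs)[->|->]]]; last first.
  - by apply: fixer_exp; rewrite weval_winv; case: (fixer_subgroup (M := M) q) => _ _; apply.
  - exact: fixer_exp.
  move=> s sq; rewrite -[LHS]/(wact hs ((v ++ [:: x]) ++ z ++ winv (v ++ [:: x])) s).
  rewrite wact_cat wact_cat [wact hs z _]zq' ?wactK//; apply: q'P; rewrite mem_cat.
  by apply/orP; right; apply/allpairsP; exists (x, s); rewrite mem_enum.
have /choice[h' h'P] i : exists h' : {ptws 'I_n -> G}, agree r (h i) h' /\
    ((i < N)%N -> B i -> ~ fixer p (weval h' (v ++ w))).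
  have [[iN Bi]|nB] := pselect ((i < N)%N /\ B i); last first.
    by exists (h i); split=> // iN Bi; case: nB.
  have FK := sub_acl (M := M) (A := F i).
  have Kt : K i (t i) by apply: FK; rewrite /F /= mem_head.
  have nst : ~ stays (h i) (K i) (t i) (v ++ w) by move=> /stays_cat; exact: vst.
  have [h' hh' h'K] := escape facl (fK i) (acl_idem (fK i)) rw Kt nst.
  exists h'; split=> [j s sr|_ _ fp].
    apply: hh'; apply: FK; rewrite /F /= inE mem_cat.
      by rewrite sr orbT.
    by apply/or3P/Or33/allpairsP; exists (j, s); rewrite mem_enum.
  by apply: h'K; rewrite /wact fp//; case: (tP i Bi).
by exists h' => i; [have [] := h'P i|have [_] := h'P i].
Qed.

(** In an open set missing all the [mostly_infinite q], each set
    [infinite_orbit_in q] would be nowhere dense, although together they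
    contain a comeager set. *)
Lemma mostly_infinite_near h p : exists2 h', agree p h h' &
  (\bigcup_q mostly_infinite q) h'.
Proof.
apply: contrapT => nO; have [F nF goodF] := hgood.
pose F' (k : nat + nat) :=
  match k with inl k => F k | inr q => infinite_orbit_in q `&` agree p h end.
have /Baire_tuples/(_ h p)[h' hh' nF'] : meager (\bigcup_k F' k).
  apply: (@meager_countable _ _ F') => // -[k|q]; first exact: nF.
  apply/seteqP; split=> // h' h'i; apply: nO; exists h'; last first.
    by exists q => //; apply: filterS h'i; apply: closure_subset => ? [].
  have /(_ _ (agree_nbhs p h'))[h'' [[_ hh''] h'h'']] : closure (F' (inr q)) h'.
    exact: nbhs_singleton h'i.
  by apply: agree_trans hh'' _; exact: agree_sym.
have [/infinite_orbit[t it] _] : ~ precompact_set (tuple_group h') /\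
    ~ discrete_set (tuple_group h').
  by apply: contrapT => /goodF[k _ Fk]; apply: nF'; exists (inl k).
apply: nF'; exists (inr (pickle t).+1) => //=; split=> //.
by exists t => //; exact: mem_tseq.
Qed.

Lemma mostly_infinite_generic : nowhere_dense
  (~` [set g : {ptws 'I_n -> H} |
       ((1 / 2)%:E < P [set x | (\bigcup_q mostly_infinite q) (values g x)])%E]).
Proof.
have oO : open (\bigcup_q mostly_infinite q).
  by apply: bigcup_open => q _; exact: open_interior.
apply: nowhere_dense_setC; first exact: open_measure_gt.
move=> g A /step_approx[N [phi [h [p [phiN gA]]]]].
have /choice[h' h'P] i : exists h', agree p (h i) h' /\ (\bigcup_q mostly_infinite q) h'.
  by have [h' hh' h'O] := mostly_infinite_near (h i) p; exists h'.
have [g' Ag' g'E] := gA h' (fun i => (h'P i).1); exists g' => //=.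
apply: (@lt_le_trans _ _ (P setT)); first by rewrite probability_setT lte_fin; lra.
apply: ae_le_measure => //; first exact: measurable_open_values.
by apply: filterS g'E => x xE _ /=; rewrite xE; exact: (h'P _).2.
Qed.

Definition coarse p q h : set {ptws 'I_n -> H} := [set g |
  forall w, nearly_trivial q h w ->
    (P [set x | ~ fixer p (weval (values g x) w)] <= (1 / 2)%:E)%E].

Definition coarse_cell p q h : set {ptws 'I_n -> H} := coarse p q h `&`
  [set g : {ptws 'I_n -> H} | ((1 / 2)%:E < P [set x | mostly_infinite p (values g x)])%E].

(** An open set inside such a cell would contain a step function whose values
    [h1 i] have infinite orbits on more than half of the space, together with
    all the step functions near it. The word and the modified values given by
    [moving_word] then violate the inequality defining [coarse]. *)
Lemma coarse_cell_nowhere_dense p q h0 : nowhere_dense (coarse_cell p q h0).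
Proof.
apply: nowhere_dense_closed_open.
- rewrite (_ : coarse p q h0 = \bigcap_(w in nearly_trivial q h0)
    [set g : {ptws 'I_n -> H} |
      (P [set x | (fun h => ~ fixer p (weval h w)) (values g x)] <= (1 / 2)%:E)%E]) //.
  apply: closed_bigI => w _.
  have onf := open_weval (n := n) w (@open_not_fixer p).
  exact: (closed_measure_le onf).
- by apply: open_measure_gt; exact: open_interior.
move=> g /step_approx[N [phi [h [r [phiN gA]]]]].
have [g0 [_ g0p] g0E] := gA h (fun i j t _ => erefl).
have /choice[h1 h1P] i : exists h1, agree r (h i) h1 /\
    (mostly_infinite p (h i) -> infinite_orbit_in p h1).
  have [hi|nhi] := pselect (mostly_infinite p (h i)); last by exists (h i).
  have /(_ _ (agree_nbhs r (h i)))[h1 [h1p hh1]] : closure (infinite_orbit_in p) (h i).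
    exact: nbhs_singleton hi.
  by exists h1.
have [w wq [h2 h12 h2w]] := @moving_word p q r h0
  (fun i => mostly_infinite p (h i)) h1 N (fun i => (h1P i).2).
have [g2 [/(_ _ wq) + _] g2E] := gA h2 (fun i => agree_trans (h1P i).1 (h12 i)).
rewrite leNgt => /negP; apply; apply: (lt_le_trans g0p); apply: ae_le_measure.
- by apply: measurable_open_values; exact: open_interior.
- exact: (measurable_open_values g2 (open_weval (V := ~` fixer p) w (open_not_fixer p))).
apply: filterS2 g0E g2E => x x0 x2 /=; rewrite x0 x2.
exact: h2w.
Qed.

(** Near any tuple there is a step function all of whose values are conjugate
    to tuples close to a single [hs] with dense diagonal class. A word that is
    trivial on a large segment at such a tuple near [hs] is trivial on the
    required segments at all the conjugates at once. *)
Lemma recurrent_comeager (W : set (seq (letter n))) :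
  (forall q h, exists2 w, W w & nearly_trivial q h w) ->
  meager (~` [set g : {ptws 'I_n -> H} | forall q, exists2 w, W w &
    (P [set x | ~ fixer q (weval (values g x) w)] < q.+1%:R^-1%:E)%E]).
Proof.
move=> WN; pose D q := [set g : {ptws 'I_n -> H} | exists2 w, W w &
  ((1 - q.+1%:R^-1)%:E < P [set x | fixer q (weval (values g x) w)])%E].
have DE q g w : ((1 - q.+1%:R^-1)%:E < P [set x | fixer q (weval (values g x) w)])%E ->
    (P [set x | ~ fixer q (weval (values g x) w)] < q.+1%:R^-1%:E)%E.
  have mw := measurable_open_values g (open_weval (V := fixer q) w (open_fixer q)).
  rewrite (_ : [set x | ~ _] = ~` [set x | fixer q (weval (values g x) w)])//.
  rewrite probability_setC//.
  by rewrite -(fineK (fin_num_measure P _ mw)) -EFinB !lte_fin; move: (_^-1) => e; lra.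
apply: (@meager_countable _ _ (fun q => ~` D q)) => [q|g nD]; last first.
  apply: contrapT => nq; apply: nD => q; have [[w Ww wq]|nDq] := pselect (D q g).
    by exists w => //; exact: DE.
  by exfalso; apply: nq; exists q.
apply: nowhere_dense_setC.
  rewrite (_ : D q = \bigcup_(w in W) [set g : {ptws 'I_n -> H} |
    ((1 - q.+1%:R^-1)%:E < P [set x | fixer q (weval (values g x) w)])%E]) //.
  apply: bigcup_open => w _.
  have ow := open_weval (n := n) w (@open_fixer _ _ M q).
  exact: (open_measure_gt _ _ ow).
move=> g A /step_approx[N [phi [h [r [phiN gA]]]]].
have [hs hsd] := hdense.
have /choice[c cP] i : exists c : G, agree r (h i) (fun j => c * hs j * c^-1)%g.
  have ne : agree r (h i) !=set0 by exists (h i).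
  have [y [hy [c _ cE]]] := hsd _ ne (@open_agree _ _ _ _ r (h i)).
  by exists c; rewrite cE.
have [q' q'P] := tseq_absorb
  [seq ((c i)^-1%g : G) t | i <- iota 0 N, t <- tseq r ++ tseq q].
have [w Ww [h' hsh' h'w]] := WN q' hs.
have cq i t : (i < N)%N -> (t \in tseq r) || (t \in tseq q) ->
    ((c i)^-1%g : G) t \in tseq q'.
  move=> iN tt; apply: q'P; apply/allpairsP; exists (i, t).
  by rewrite mem_iota mem_cat.
pose h2 i : {ptws 'I_n -> G} :=
  if (i < N)%N then (fun j => c i * h' j * (c i)^-1)%g else h i.
have h2P i : agree r (h i) (h2 i).
  rewrite /h2; case: ifP => // iN j t tr; rewrite -(cP i j t tr) !autM.
  by rewrite hsh'// cq// tr.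
have [g' Ag' g'E] := gA h2 h2P; exists g' => //; exists w => //.
apply: (@lt_le_trans _ _ (P setT)).
  by rewrite probability_setT lte_fin ltrBlDr ltrDl invr_gt0.
apply: ae_le_measure => //.
  exact: (measurable_open_values g' (open_weval (V := fixer q) w (open_fixer q))).
apply: filterS g'E => x xE _ /=; rewrite xE /h2 phiN.
have -> : weval (fun j => c (phi x) * h' j * (c (phi x))^-1)%g w =
    (c (phi x) * weval h' w * (c (phi x))^-1)%g.
  elim: (w) => [|l u IH]; first by rewrite /= mulg1 mulgV.
  rewrite /= IH; case: l => j [] /=; rewrite /leval /= ?invgM ?invgK !mulgA.
    by rewrite mulgVK.
  by rewrite mulgVK.
move=> t tq; rewrite !autM h'w ?autKV//.
by apply: cq => //; apply/orP; right.
Qed.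

(** Countably many cells and one further nowhere dense set are at hand. A
    member [g] of the class outside of all of them comes with a set [W] of words
    that stays away from the identity at [g], hence at all members of
    the class, whereas it returns to the identity at comeagerly many tuples. *)
Theorem similarity_class_meager (f : {ptws 'I_n -> H}) : meager (similarity_class f).
Proof.
have [rep repP] := snapshot_rep (M := M) (n := n).
pose F (i : option (nat * nat * {ffun 'I_n -> seq T})) :=
  if i is Some (p, q, c) then coarse_cell p q (rep q c)
  else ~` [set g : {ptws 'I_n -> H} |
    ((1 / 2)%:E < P [set x | (\bigcup_q mostly_infinite q) (values g x)])%E].
apply: contrapT => nm; apply: (nm); apply: (@meager_countable _ _ F).
  by move=> [[[p q] c]|]; [exact: coarse_cell_nowhere_dense|exact: mostly_infinite_generic].
move=> g fg; apply: contrapT => nFg.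
have gI : ((1 / 2)%:E < P [set x | (\bigcup_q mostly_infinite q) (values g x)])%E.
  by apply: contrapT => ngI; apply: nFg; exists None.
have [p gp] : exists p, ((1 / 2)%:E < P [set x | mostly_infinite p (values g x)])%E.
  apply: (lt_measure_bigcup (F := fun p => [set x | mostly_infinite p (values g x)])).
  - by move=> p; apply: measurable_open_values; exact: open_interior.
  - by move=> p q pq; apply/subsetPset => x; exact: mostly_infinite_mono.
  - by rewrite (_ : \bigcup_i _ = [set x | (\bigcup_q mostly_infinite q) (values g x)]).
pose W w := ((1 / 2)%:E < P [set x | ~ fixer p (weval (values g x) w)])%E.
have WN q h : exists2 w, W w & nearly_trivial q h w.
  apply: contrapT => nW; apply: nFg; exists (Some (p, q, snapshot q h)) => //.
  split=> // w /(nearly_trivial_agree (agree_sym (repP q h))) wq.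
  by rewrite leNgt; apply/negP => Ww; apply: nW; exists w.
apply: nm; have [D nD WD] := recurrent_comeager WN; exists D => // g' fg'.
apply: WD => acc.
have nbA : nbhs (1%g : H) [set k : H | (P [set x | ~ fixer p (k x)] < (1 / 2)%:E)%E].
  exists (fixer p, 1 / 2) => /=.
    by split; [split; [exact: open_fixer|case: (fixer_subgroup (M := M) p)]|lra].
  by move=> _ [k kp <-]; rewrite mul1g.
have [[B1 nB1 B1A] _] := similar_nbhs fg nbA.
have [_ [B [[V e] [/= [oV V1] e0] VB] BB1]] := similar_nbhs fg' nB1.
have /fixer_nbhs1[q1 q1V] : nbhs (1%g : G) V by exact: open_nbhs_nbhs.
have [k ke] := ltr_add_invr e0; rewrite add0r in ke.
have [w Ww wq] := acc (maxn q1 k).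
have mo (m : nat) (u : {ptws 'I_n -> H}) := measurable_open_values u
  (open_weval (V := ~` fixer m) w (open_not_fixer m)).
have : B (weval g' w).
  apply: VB; exists (weval g' w); last exact: mul1g.
  apply: le_lt_trans (lt_trans wq _); last first.
    rewrite lte_fin; apply: le_lt_trans ke; rewrite lef_pV2 ?posrE// ler_nat ltnS.
    exact: leq_maxr.
  apply: ae_le_measure; [exact: measurable_notin|exact: mo|].
  apply: filterS (ae_weval g' w) => x /= ->; apply: contra_not => xq; apply: q1V.
  exact: fixer_mono (leq_maxl _ _) _ xq.
move=> /BB1/B1A; rewrite /= ltNge => /negP; apply; apply: ltW; apply: (lt_le_trans Ww).
apply: ae_le_measure; [exact: mo|by apply: measurable_notin; exact: open_fixer|].
by apply: filterS (ae_weval g w) => x /= ->.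
Qed.

End generic.
End main.

Theorem theorem4p16 (R : realType) (L : language) (T : countType)
    (M : structure L T) (n : nat) :
  locally_finite M ->
  (forall A : set T, finite_set A -> finite_set (acl M A)) ->
  (1 <= n)%N ->
  (exists h : {ptws 'I_n -> Aut M}, dense (diagonal_class h)) ->
  comeager [set h : {ptws 'I_n -> Aut M} |
    ~ precompact_set (tuple_group h) /\ ~ discrete_set (tuple_group h)] ->
  forall f : {ptws 'I_n -> L0 (@unit_lebesgue R) (Aut M)},
    meager (similarity_class f).
Proof.
move=> _ facl n0 hdense hgood f.
exact: (@similarity_class_meager _ _ R (@unit_lebesgue R) L T M n facl n0 hdense hgood f).
Qed.
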